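(* Let $P$ be a poset of height $2$ that has a $k$-partite representation for some integer $k\geq 2$. Then \[ \mathrm{La}(n,P)=(1+o(1))\binom{n}{\lfloor n/2\rfloor}\qquad (n\to\infty). \]
   Context: For posets $P=(P,\le)$ and $P'=(P',\le')$, $P'$ is a (weak) subposet of $P$ if there is an injection $f\colon P'\to P$ such that $u\le' v$ implies $f(u)\le f(v)$. The height of a poset is the maximum size of a chain in it. A family $\mathcal{F}$ of subsets of $[n]=\{1,\dots,n\}$ is $P$-free if $P$ is not a weak subposet of $(\mathcal{F},\subseteq)$; $\mathrm{La}(n,P)$ is the largest size of a $P$-free family of subsets of $[n]$. A poset $P$ of height $2$ has a $k$-partite representation if there exist an integer $l$ and a family $\mathcal{P}\subseteq\binom{[l]}{k-1}\cup\binom{[l]}{k}$ such that (i) the poset $(\mathcal{P},\subseteq)$ contains $P$ as a weak subposet, and (ii) the $k$-uniform hypergraph $G(\mathcal{P})$ with vertex set $[l]$ and edge set $\mathcal{P}\cap\binom{[l]}{k}$ is $k$-partite (its vertex set can be partitioned into $k$ parts so that every edge meets each part in exactly one vertex). *)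

(* Defs.v *)
From mathcomp Require Import all_boot all_order all_algebra.
Set Implicit Arguments. Unset Strict Implicit. Unset Printing Implicit Defensive.

Definition is_partial_order (T : finType) (le : rel T) : Prop :=
  [/\ reflexive le, antisymmetric le & transitive le].

Definition chainb (T : finType) (le : rel T) (C : {set T}) : bool :=
  [forall x in C, forall y in C, le x y || le y x].

Definition height (T : finType) (le : rel T) : nat :=
  \max_(C : {set T} | chainb le C) #|C|.

Definition weak_subposet (T U : finType) (le : rel T) (F : {set {set U}}) : bool :=
  [exists f : {ffun T -> {set U}},
     [&& injectiveb f, [forall u, f u \in F] &
         [forall u, forall v, le u v ==> (f u \subset f v)]]].

Definition La (T : finType) (le : rel T) (n : nat) : nat :=
  \max_(F : {set {set 'I_n}} | ~~ weak_subposet le F) #|F|.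

Definition k_partite (l k : nat) (E : {set {set 'I_l}}) : Prop :=
  exists c : 'I_l -> 'I_k,
    forall e, e \in E -> forall i : 'I_k, #|[set x in e | c x == i]| = 1.

Definition k_partite_representation (T : finType) (le : rel T) (k : nat) : Prop :=
  exists l : nat, exists Pf : {set {set 'I_l}},
    [/\ (forall A, A \in Pf -> #|A| = k.-1 \/ #|A| = k),
        weak_subposet le Pf
      & k_partite k [set A in Pf | #|A| == k]].

(* Main.v *)
Require Import Defs.
From mathcomp Require Import all_boot all_order all_algebra all_fingroup.
From mathcomp Require Import zify ring lra.
Set Implicit Arguments. Unset Strict Implicit. Unset Printing Implicit Defensive.
Import Order.TTheory GRing.Theory Num.Theory.
Local Open Scope ring_scope.

(** The middle level gives the lower bound.  For the upper bound let [F] be a [P]-free family.  Sets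
    far from the middle level are negligible, so [F] may be assumed to lie in a band of
    levels of width at most a small multiple of [n].  Take a uniformly random maximal chain and let
    [X] be the number of its members in [F]; it suffices to bound [E X] by [1 + o(1)].

    If [E X >= 1 + e], then a positive proportion (weighted by [F]) of the pairs
    (member [B] of [F], chain through [B]) meet [F] again below [B].  Cutting the random order of the
    elements of [B] into disjoint segments, each segment hits [F] with the same probability, so with
    constant probability [k] of them do: [B] and [B \ D_i] lie in [F] for disjoint [D_1, ..., D_k] of
    sizes [d_i].  Either one gap [d] can be imposed on all segments, at a cost exponential in [d], or
    all the gaps exceed a multiple of [log n] and prescribing them costs a power of [n].  In both cases
    the event has, relative to the density of [F] on each of the levels [|B| - d_i], probability at
    least [theta ^ d_i] with [theta] constant.

    The configuration is then blown up: [D_i] is chosen among [R ^ d_i] sets living in its own region,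
    and one copy of [D_i] is replaced by [t] independent ones, one [i] at a time.  By convexity the
    probability that all [t ^ k] transversal configurations are in [F] is at least
    [theta ^ (d_i t ^ k)] relative to the density of the level [|B| - d_i], whereas two copies of [D_i]
    coincide with relative probability [R ^ - d_i].  For [R] large some blow-up is
    nondegenerate, and it contains [P]. *)

(** * Blowing up a k-partite configuration *)

Definition upd (I : finType) (U : Type) (y : {ffun I -> U}) (j : I) (u : U) :
  {ffun I -> U} := [ffun i => if i == j then u else y i].

(* [(y, u) |-> (y with y j := u, y j)] is an involution. *)
Lemma sum_upd (I U : finType) (j : I) (F : {ffun I -> U} -> rat) :
  \sum_y \sum_u F (upd y j u) = #|U|%:R * \sum_y F y.
Proof.
rewrite pair_big /=.
pose sw (p : {ffun I -> U} * U) := (upd p.1 j p.2, p.1 j).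
have swK : involutive sw.
  move=> [y u]; rewrite /sw /=; congr pair; last by rewrite ffunE eqxx.
  by apply/ffunP=> i; rewrite !ffunE; case: eqP => [->|].
rewrite (reindex_inj (inv_inj swK)) /=.
under eq_bigr => p _ do rewrite (congr1 fst (swK p) : upd (sw p).1 j (sw p).2 = p.1).
rewrite -(pair_big xpredT xpredT (fun y _ => F y)) /=.
by rewrite mulr_sumr; apply: eq_bigr => y _; rewrite sumr_const mulr_natl.
Qed.

(** The power lies above its tangent at [r]: after multiplying the bound for [t] by [x], the two
    successive bounds differ by [(t + 1) r ^ t (x - r) ^ 2]. *)
Lemma expr_tangent (t : nat) (x r : rat) : 0 <= x -> 0 <= r ->
  t.+1%:R * r ^+ t * x - t%:R * r ^+ t.+1 <= x ^+ t.+1.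
Proof.
move=> x0 r0; elim: t => [|t IH]; first by rewrite expr0 expr1; lra.
have := ler_wpM2l x0 IH; rewrite -exprS; apply: le_trans.
rewrite -subr_ge0.
have -> : x * (t.+1%:R * r ^+ t * x - t%:R * r ^+ t.+1) -
  (t.+2%:R * r ^+ t.+1 * x - t.+1%:R * r ^+ t.+2) = t.+1%:R * r ^+ t * (x - r) ^+ 2.
  by rewrite !exprS -!natr1; ring.
by rewrite mulr_ge0 ?sqr_ge0 // mulr_ge0 // exprn_ge0.
Qed.

(** Coordinate [i] carries the copies [y i a] for [a] in [K]; [e] picks one copy of each, a
    transversal. *)
Definition sel (I K : finType) (Om : Type) (y : {ffun I -> {ffun K -> Om}}) (e : {ffun I -> K}) :
  {ffun I -> Om} := [ffun i => y i (e i)].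

Section Blowup.
Variables (S Om K : finType) (k : nat) (k0 : K).
Variables (G : S -> {ffun 'I_k -> Om} -> bool).
Variable (V : 'I_k -> S -> {ffun 'I_k -> Om} -> bool).
Hypothesis Vind : forall i s (x x' : {ffun 'I_k -> Om}), (forall j, j != i -> x j = x' j) -> V i s x = V i s x'.
Hypothesis GV : forall i s x, G s x -> V i s x.
Hypothesis Om_gt0 : (0 < #|Om|)%N.

Notation Y := {ffun 'I_k -> {ffun K -> Om}}.
Notation c0 := ([ffun=> k0] : {ffun 'I_k -> K}).

(** Interpolates between a single configuration, at [j = 0], and all transversals, at [j = k]: only
    the coordinates below [j] range over their copies, the others keep copy [k0]. *)
Let H (j : nat) s (y : Y) : bool :=
  [forall e : {ffun 'I_k -> K}, [forall i : 'I_k, (j <= i)%N ==> (e i == k0)] ==> G s (sel y e)].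

Let HS (j : 'I_k) s y u :
  H j.+1 s (upd y j u) = [forall a, H j s (upd y j [ffun=> u a])].
Proof.
apply/idP/idP.
  move=> /forallP h; apply/forallP => a; apply/forallP => e; apply/implyP => /forallP he.
  have := h (upd e j a); rewrite (_ : [forall _, _] = true) /=.
    congr G; apply/ffunP => i; rewrite !ffunE.
    by case: (_ =P j) => // ->; rewrite ffunE.
  apply/forallP => i; apply/implyP => ij; rewrite ffunE.
  case: (i =P j) => [eij|_]; first by rewrite eij ltnn in ij.
  by have := he i; rewrite (ltnW ij).
move=> /forallP h; apply/forallP => e; apply/implyP => /forallP he.
have /forallP /(_ (upd e j k0)) := h (e j); rewrite (_ : [forall _, _] = true) /=.
  congr G; apply/ffunP => i; rewrite !ffunE.
  by case: (_ =P j) => // ->; rewrite ffunE.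
apply/forallP => i; apply/implyP => ij; rewrite ffunE.
case: (i =P j) => [//|/eqP eij].
by have := he i; rewrite ltn_neqAle ij andbT eq_sym (inj_eq val_inj) eij.
Qed.

Let Hk s y : H k s y = [forall e, G s (sel y e)].
Proof.
apply/eq_forallb => e; rewrite (_ : [forall _, _] = true) //.
by apply/forallP => i; rewrite leqNgt ltn_ord.
Qed.

Let H0 s y : H 0 s y = G s (sel y c0).
Proof.
apply/forallP/idP => [/(_ c0)|h e].
  by rewrite (_ : [forall _, _] = true) //; apply/forallP => i; rewrite ffunE eqxx.
apply/implyP => /forallP he; rewrite (_ : e = c0) //.
by apply/ffunP => i; rewrite ffunE; apply/eqP/he.
Qed.

Let Hloc (j : 'I_k) s y u : H j s (upd y j u) = H j s (upd y j [ffun=> u k0]).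
Proof.
apply: eq_forallb => e; case: (boolP [forall _, _]) => //= /forallP he; congr G.
apply/ffunP => i; rewrite !ffunE; case: (_ =P j) => // ->; rewrite ffunE.
by have := he j; rewrite leqnn => /eqP ->.
Qed.

Let HV (j : 'I_k) s y u : H j s (upd y j u) -> V j s (sel y c0).
Proof.
move=> /forallP /(_ c0); rewrite (_ : [forall _, _] = true) /=; last first.
  by apply/forallP => i; rewrite ffunE eqxx implybT.
move=> /(GV j); rewrite (@Vind j s _ (sel y c0)) // => i ij.
by rewrite !ffunE (negPf ij).
Qed.

Let N : rat := #|Om|%:R.
(** The conditional probability of [H j] when coordinate [j] is redrawn uniformly. Its mean is that
    of [H j], and its power [#|K|] is the chance that [#|K|] independent copies all succeed, which
    is [H j.+1]. *)
Let g (j : 'I_k) s (y : Y) : rat := N^-1 * \sum_w (H j s (upd y j [ffun=> w]))%:R.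

Let N0 : N != 0. Proof. by rewrite pnatr_eq0 -lt0n. Qed.

Let sum_g (j : 'I_k) s : \sum_y g j s y = \sum_y (H j s y)%:R.
Proof.
have cU : #|{: {ffun K -> Om}}|%:R != 0 :> rat.
  by rewrite pnatr_eq0 card_ffun expn_eq0 negb_and -lt0n Om_gt0.
apply: (mulfI cU); rewrite -[RHS](sum_upd j) mulr_sumr; apply: eq_bigr => y _.
apply: (mulfI N0); rewrite mulrCA /g mulVKf //.
rewrite [in RHS](eq_bigr _ (fun u _ => congr1 (fun b : bool => b%:R) (Hloc j s y u))).
rewrite -(sum_upd k0 (fun u : {ffun K -> Om} => (H j s (upd y j [ffun=> u k0]))%:R)).
rewrite [LHS]mulr_natl -sumr_const; apply: eq_big => // u _.
by apply: eq_bigr => w _; rewrite ffunE eqxx.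
Qed.

Let sum_gX (j : 'I_k) s : \sum_y g j s y ^+ #|K| = \sum_y (H j.+1 s y)%:R.
Proof.
have cU : #|{: {ffun K -> Om}}|%:R != 0 :> rat.
  by rewrite pnatr_eq0 card_ffun expn_eq0 negb_and -lt0n Om_gt0.
apply: (mulfI cU); rewrite -[RHS](sum_upd j) mulr_sumr; apply: eq_bigr => y _.
rewrite card_ffun natrX -exprMn /g mulVKf // -prodr_const bigA_distr_bigA /=.
apply: eq_bigr => u _; rewrite HS.
case: (boolP [forall _, _]) => [/forallP h|].
  by rewrite big1 // => a _; rewrite h.
rewrite negb_forall => /existsP [a /negPf ha].
by rewrite (bigD1 a) //= ha mul0r.
Qed.

(* [v] bounds the measure of each [V i], which does not see the coordinate [i] that is being
   multiplied; on its support the fibres of [G] have average at least [r], so Jensen's inequality, in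
   its tangent-line form, turns the relative density [r] into [r ^ #|K|] at each of the [k] steps. *)
Lemma blowup (v r : rat) : 0 <= r ->
  (forall i, \sum_s \sum_(y : Y) (V i s (sel y c0))%:R <= v) ->
  r * v <= \sum_s \sum_(y : Y) (G s (sel y c0))%:R ->
  r ^+ (#|K| ^ k) * v <= \sum_s \sum_(y : Y) [forall e : {ffun 'I_k -> K}, G s (sel y e)]%:R.
Proof.
move=> r0 hV hG.
suff hj j : (j <= k)%N -> r ^+ (#|K| ^ j) * v <= \sum_s \sum_y (H j s y)%:R.
  apply: le_trans (hj k (leqnn k)) _; apply: ler_sum => s _; apply: ler_sum => y _.
  by rewrite Hk.
elim: j => [_|j IH jk].
  by rewrite expn0 expr1; apply: le_trans hG _; under eq_bigr => s _ do under eq_bigr => y _ do rewrite -H0.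
have {IH} := IH (ltnW jk); set q := r ^+ _ => hq.
have q0 : 0 <= q by rewrite exprn_ge0.
have [t tE] : exists t, #|K| = t.+1 by exists #|K|.-1; rewrite prednK //; apply/card_gt0P; exists k0.
rewrite expnSr exprM -/q; pose jo := Ordinal jk.
under eq_bigr => s _ do rewrite -(sum_gX jo).
(* Off [V jo] the value [g] is zero, so the constant term of the tangent line is paid only on
   [V jo], whose total is at most [v]. *)
have gl s (y : Y) : t.+1%:R * q ^+ t * g jo s y - t%:R * q ^+ t.+1 * (V jo s (sel y c0))%:R <= g jo s y ^+ #|K|.
  rewrite tE; case: (boolP (V jo s _)) => hVs.
    rewrite mulr1; apply: expr_tangent => //.
    by rewrite mulr_ge0 ?invr_ge0 ?ler0n ?sumr_ge0.
  rewrite [g jo s y](_ : _ = 0) ?mulr0 ?subr0 ?expr0n //.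
  rewrite /g big1 ?mulr0 // => w _; case: (boolP (H _ _ _)) => // /HV h.
  by rewrite h in hVs.
have : \sum_s \sum_(y : Y) (t.+1%:R * q ^+ t * g jo s y - t%:R * q ^+ t.+1 * (V jo s (@sel _ K _ y c0))%:R)
   <= \sum_s \sum_(y : Y) g jo s y ^+ #|K|.
  by apply: ler_sum => s _; apply: ler_sum => y _; apply: gl.
apply: le_trans; under eq_bigr => s _ do rewrite sumrB -mulr_sumr sum_g -mulr_sumr.
rewrite sumrB -!mulr_sumr tE.
have h1 := ler_wpM2l (_ : 0 <= t.+1%:R * q ^+ t) hq.
have h2 := ler_wpM2l (_ : 0 <= t%:R * q ^+ t.+1) (hV jo).
apply: le_trans (lerB (h1 _) (h2 _)); rewrite ?mulr_ge0 ?exprn_ge0 //.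
by rewrite !exprS -natr1 le_eqVlt; apply/orP; left; apply/eqP; ring.
Qed.

End Blowup.
(** * Random maximal chains *)

Lemma perm_coloring n (C : finType) (h h' : 'I_n -> C) :
  (forall c, #|[set x | h x == c]| = #|[set x | h' x == c]|) ->
  exists t : 'S_n, forall x, h' (t x) = h x.
Proof.
move=> hc; have /tuple_permP [p hp] : perm_eq [tuple h x | x < n] [tuple h' x | x < n].
  apply/allP => c _ /=; apply/eqP.
  have cnt (f : 'I_n -> C) : count_mem c [seq f x | x <- enum 'I_n] = #|[set x | f x == c]|.
    by rewrite count_map cardsE cardE size_filter enumT.
  by rewrite !cnt.
exists p => x.
have := congr1 (fun s : seq C => nth (h x) s x) hp.
by rewrite -!tnth_nth !tnth_mktuple.
Qed.

Section SetColoring.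
Variables (n k : nat).
Implicit Types (B : {set 'I_n}) (I D : 'I_k -> {set 'I_n}).

(** The class sizes of this colouring depend only on the sizes of [B] and of the [I i], so
    [perm_coloring] matches any two configurations with equal sizes. *)
Let col B I x : bool * option 'I_k := (x \in B, [pick i | x \in I i]).

Let card_col B I : (forall i, I i \subset B) -> (forall i j, i != j -> [disjoint I i & I j]) ->
  forall c, #|[set x | col B I x == c]| =
  match c with
  | (true, Some i) => #|I i| | (false, Some i) => 0
  | (true, None) => #|B| - \sum_i #|I i| | (false, None) => n - #|B|
  end%N.
Proof.
move=> IB dis.
have pickI x i : x \in I i -> [pick j | x \in I j] = Some i.
  move=> xi; case: pickP => [j xj|/(_ i)]; last by rewrite xi.
  congr Some; apply/eqP; apply/negP => /negP /dis /disjoint_setI0 /setP /(_ x).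
  by rewrite !inE xi xj.
have pickN x : x \notin \bigcup_i I i -> [pick j | x \in I j] = None.
  move=> xn; case: pickP => // j xj; case/negP: xn; apply/bigcupP; by exists j.
have cU : #|\bigcup_i I i| = (\sum_i #|I i|)%N.
  rewrite -sum1_card partition_disjoint_bigcup //.
  by apply: eq_bigr => i _; rewrite sum1_card.
have UB : \bigcup_i I i \subset B by apply/bigcupsP.
have E x c : (col B I x == c) = (x \in B == c.1) && ([pick j | x \in I j] == c.2).
  by rewrite /col; case: c => a b; rewrite xpair_eqE.
case=> [[] [i|]].
- apply: eq_card => x; rewrite inE E /=; apply/andP/idP => [[_]|xi].
    by case: pickP => // j xj /eqP [<-].
  by rewrite (subsetP (IB i)) // (pickI _ _ xi).
- rewrite -cU -cardsDS //; apply: eq_card => x; rewrite !inE E /= andbC eqb_id.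
  case: (boolP (x \in \bigcup_i _)) => [/bigcupP [i _ xi]|/pickN -> //].
  by rewrite (pickI _ _ xi).
- apply: eq_card0 => x; rewrite inE E /=; case: pickP => [j /(subsetP (IB j)) ->//|].
  by rewrite andbF.
- transitivity (#|[set: 'I_n]| - #|B|)%N; last by rewrite cardsT card_ord.
  rewrite -cardsDS ?subsetT //; apply: eq_card => x.
  rewrite !inE E /= andbT eqbF_neg; case xB: (x \in B) => //=.
  by rewrite pickN //; apply: contraFN xB; apply: (subsetP UB).
Qed.

Lemma perm_sets B B' I I' :
  (forall i, I i \subset B) -> (forall i j, i != j -> [disjoint I i & I j]) ->
  (forall i, I' i \subset B') -> (forall i j, i != j -> [disjoint I' i & I' j]) ->
  #|B| = #|B'| -> (forall i, #|I i| = #|I' i|) ->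
  exists t : 'S_n, t @: B = B' /\ forall i, t @: I i = I' i.
Proof.
move=> IB dis IB' dis' cB cI.
have [c|t ht] := @perm_coloring n _ (col B I) (col B' I').
  by rewrite !card_col //; case: c => [[] [i|]] //; rewrite -?cB //; congr subn; apply: eq_bigr.
have hB x : (t x \in B') = (x \in B) by have := congr1 fst (ht x).
have hI i x : x \in I i -> t x \in I' i.
  move=> xi; have := congr1 snd (ht x); rewrite /=.
  case: (pickP (fun i => x \in I i)) => [j xj|/(_ i)]; last by rewrite xi.
  case: pickP => // j' xj' [jj']; suff <- : j' = i by [].
  rewrite jj'; apply/eqP; apply/negP => /negP /dis /disjoint_setI0 /setP /(_ x).
  by rewrite !inE xi xj.
exists t; split=> [|i]; apply/eqP; rewrite eqEcard card_imset ?cB ?cI ?leqnn ?andbT; try exact: perm_inj.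
  by apply/subsetP => _ /imsetP [x xB ->]; rewrite hB.
by apply/subsetP => _ /imsetP [x xB ->]; apply: hI.
Qed.

End SetColoring.

Lemma perm_set n (B B' : {set 'I_n}) : #|B| = #|B'| -> exists t : 'S_n, t @: B = B'.
Proof.
move=> cB; have [] // := @perm_sets n 0 B B' (fun=> set0) (fun=> set0); try by case.
by move=> t [tB _]; exists t.
Qed.

Lemma imset_permM n (s t : 'S_n) (I : {set 'I_n}) : (t * s)%g @: I = s @: (t @: I).
Proof. by rewrite -imset_comp; apply: eq_imset => x; rewrite permM. Qed.

Lemma card_permMl n (t : 'S_n) (Q : pred 'S_n) : #|[set s | Q (t * s)%g]| = #|[set s | Q s]|.
Proof.
rewrite -[RHS](card_preimset _ (mulgI t)).
by apply: eq_card => s; rewrite !inE.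
Qed.

Lemma card_permMr n (t : 'S_n) (Q : pred 'S_n) : #|[set s | Q (s * t)%g]| = #|[set s | Q s]|.
Proof.
rewrite -[RHS](card_preimset _ (mulIg t)).
by apply: eq_card => s; rewrite !inE.
Qed.

(** For uniform [s], the sets [s @: iseg n b] with [b = 0, ..., n] form a uniformly random maximal
    chain. *)
Definition iseg n b : {set 'I_n} := [set x : 'I_n | (x < b)%N].

Lemma card_iseg n b : (b <= n)%N -> #|iseg n b| = b.
Proof.
move=> bn; rewrite -sum1_card (eq_bigl (fun x : 'I_n => (x < b)%N)) => [|x]; last by rewrite inE.
by rewrite (big_ord_narrow bn) /= sum1_card card_ord.
Qed.

Section Beta.
Variables (n : nat) (F : {set {set 'I_n}}).

(* Up to the factor [n!], the probability that a random maximal chain meets [F] at level [b]. *)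
Definition beta b := #|[set s : 'S_n | s @: iseg n b \in F]|.

Lemma card_imset_in (I : {set 'I_n}) : #|[set s : 'S_n | s @: I \in F]| = beta #|I|.
Proof.
have [t tI] : exists t : 'S_n, t @: iseg n #|I| = I.
  by apply: perm_set; rewrite card_iseg //; apply: leq_trans (max_card _) _; rewrite card_ord.
rewrite /beta -[RHS](card_permMl t); apply: eq_card => s; rewrite !inE imset_permM tI //.
Qed.

(** Every set of size [b] is the image of [iseg n b] under equally many permutations, so [F] and the
    whole level are counted with the same multiplicity. *)
Lemma card_level b : (b <= n)%N -> (#|[set A in F | #|A| == b]| * n`! = 'C(n, b) * beta b)%N.
Proof.
move=> bn.
pose c (A : {set 'I_n}) := #|[set s : 'S_n | s @: iseg n b == A]|.
have cE (A : {set 'I_n}) : #|A| = b -> c A = c (iseg n b).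
  move=> cA; have [t tA] : exists t : 'S_n, t @: A = iseg n b.
    by apply: perm_set; rewrite card_iseg.
  rewrite /c -[RHS](card_permMr t); apply: eq_card => s; rewrite !inE imset_permM.
  apply/eqP/eqP => [-> //|h]; apply: (imset_inj (@perm_inj _ t)).
  by rewrite h tA.
have cimg (s : 'S_n) : #|s @: iseg n b| = b by rewrite card_imset ?card_iseg //; apply: perm_inj.
have tot (P : pred {set 'I_n}) : #|[set s : 'S_n | P (s @: iseg n b)]| =
   (#|[set A : {set 'I_n} | P A & #|A| == b]| * c (iseg n b))%N.
  rewrite -sum1dep_card (partition_big (fun s : 'S_n => s @: iseg n b)
     (fun A : {set 'I_n} => P A && (#|A| == b))) /=; last by move=> s ->; rewrite cimg eqxx.
  rewrite -sum_nat_cond_const; apply: eq_bigr => A.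
  move=> /andP [PA /eqP cA].
  rewrite -(cE A) // /c -sum1dep_card; apply: eq_bigl => s.
  by case: eqP => [->|]; rewrite ?PA ?andbF.
have e1 : #|[set s : 'S_n | predT (s @: iseg n b)]| = n`!.
  rewrite (_ : [set s | _] = setT) ?cardsT; first by rewrite -[RHS]card_Sn; apply: eq_card.
  by apply/setP => s; rewrite !inE.
have e2 : #|[set A : {set 'I_n} | predT A & #|A| == b]| = 'C(n, b).
  transitivity 'C(#|'I_n|, b); last by rewrite card_ord.
  by rewrite -card_draws; apply: eq_card => A; rewrite !inE.
by rewrite -e1 (tot predT) e2 /beta (tot (fun A => A \in F)) mulnCA.
Qed.

End Beta.
(** * Disjoint segments hitting the family *)

Definition segment n b q d : {set 'I_n} := [set x : 'I_n | (b - q - d <= x < b - q)%N].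

Lemma iseg_segment n b d : iseg n b :\: segment n b 0 d = iseg n (b - d).
Proof. by apply/setP => x; rewrite !inE; lia. Qed.

(** Exchanges the top block of length [l] with the block at offset [q] from the top; these are equal
    or disjoint, and the translations between them respect the shorter segments at their upper
    ends. *)
Lemma segment_swap n b q l : q = 0 \/ (l <= q)%N -> (q + l <= b <= n)%N ->
  exists t : 'S_n, forall d, (d <= l)%N ->
    t @: (iseg n b :\: segment n b 0 d) = iseg n b :\: segment n b q d.
Proof.
move=> hq hb.
pose sw x := (if b - l <= x < b then x - q else
              if b - q - l <= x < b - q then x + q else x)%N.
have sw_lt x : (x < n -> sw x < n)%N by rewrite /sw; do !case: ifP; lia.
(* By [sw_lt] the value is in range, so the default of [insubd] never occurs. *)
pose f (x : 'I_n) := insubd x (sw x).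
have fE x : f x = sw x :> nat by rewrite val_insubd sw_lt.
have fK : involutive f.
  by move=> x; apply: val_inj; rewrite /= !fE /sw; do !case: ifP; lia.
exists (perm (inv_inj fK)) => d dl.
rewrite (eq_imset _ (permE _)) (can_imset_pre _ fK); apply/setP => x.
by rewrite !inE fE /sw; do !case: ifP; lia.
Qed.

Lemma card_segment n b q d : (q + d <= b <= n)%N -> #|segment n b q d| = d.
Proof.
move=> h; have -> : segment n b q d = iseg n (b - q) :\: iseg n (b - q - d).
  by apply/setP => x; rewrite !inE; lia.
rewrite cardsDS ?card_iseg; try lia.
by apply/subsetP => x; rewrite !inE; lia.
Qed.

(** The condition [m <= b] keeps the truncated subtraction exact, so the left sum is a part of the
    right one. *)
Lemma sum_beta_shift n F d (m : nat) : (d <= m)%N ->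
  (\sum_(b < n.+1 | m <= b) @beta n F (b - d) <= \sum_(b < n.+1) beta F b)%N.
Proof.
move=> dm; rewrite -(big_mkord xpredT (beta F)).
rewrite -(big_mkord (fun b => (m <= b)%N) (fun b => beta F (b - d))).
rewrite -(big_nat_widenl _ _ _ xpredT) //.
have [nm|mn] := leqP n.+1 m; first by rewrite big_geq.
rewrite -{1}[m](subnK dm) big_addn.
under eq_bigr => b _ do rewrite addnK.
rewrite [X in (_ <= X)%N](@big_cat_nat _ _ _ (m - d)) //=; last by lia.
rewrite [X in (_ <= _ + X)%N](@big_cat_nat _ _ _ (n.+1 - d)) //=; try lia.
Qed.

Section Key.
Variables (n : nat) (F : {set {set 'I_n}}) (k : nat).

Definition gap_count (D : {set 'I_n.+1}) b :=
  #|[set s : 'S_n | (s @: iseg n b \in F) && [exists d in D, s @: iseg n (b - d) \in F]]|.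

Definition joint (B : {set 'I_n}) (I : 'I_k -> {set 'I_n}) :=
  #|[set s : 'S_n | (s @: B \in F) && [forall i, s @: (B :\: I i) \in F]]|.

Variables (D : {set 'I_n.+1}) (l M : nat).
Hypothesis Dl : forall d, d \in D -> (d <= l)%N.

(** Blocks have length [l] and are counted from the top; a hit removes from block [j] a segment
    aligned with its upper end, so hits in different blocks remove disjoint sets. *)
Let hit b (s : 'S_n) (j : nat) :=
  [exists d in D, s @: (iseg n b :\: segment n b (j * l) d) \in F].

Let card_hit b j : (M * l <= b <= n)%N -> (j < M)%N ->
  #|[set s : 'S_n | (s @: iseg n b \in F) && hit b s j]| = gap_count D b.
Proof.
move=> hb jM.
have [||t ht] := @segment_swap n b (j * l) l.
- by case: j jM => [|j] _; [left|right; rewrite leq_pmull].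
- by rewrite -mulSnr; case/andP: hb => hb ->; rewrite andbT (leq_trans _ hb) // leq_mul2r jM orbT.
rewrite -[RHS](card_permMl t); apply: eq_card => s; rewrite !inE !imset_permM.
have := ht 0 isT; rewrite iseg_segment subn0 (_ : segment _ _ _ 0 = set0); last first.
  by apply/setP => x; rewrite !inE; lia.
rewrite setD0 => ->; congr andb; apply: eq_existsb => d.
case: (boolP (d \in D)) => //= dD; rewrite imset_permM -ht ?Dl //.
by rewrite iseg_segment.
Qed.

Let many b := #|[set s : 'S_n | (s @: iseg n b \in F) && (k <= #|[set j : 'I_M | hit b s j]|)%N]|.

Let le_many b : (M * l <= b <= n)%N -> (M * gap_count D b <= k * beta F b + M * many b)%N.
Proof.
move=> hb.
have -> : (M * gap_count D b = \sum_(s : 'S_n | s @: iseg n b \in F) #|[set j : 'I_M | hit b s j]|)%N.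
  under eq_bigr => s _ do rewrite -sum1dep_card big_mkcond /=.
  rewrite exchange_big /= -{1}[M]card_ord -sum_nat_const.
  apply: eq_bigr => j _; rewrite -(card_hit hb (ltn_ord j)) -sum1dep_card.
  by rewrite big_mkcondr.
rewrite /beta /many -!sum1dep_card !big_distrr /= [X in (_ <= _ + X)%N]big_mkcondr -big_split /=.
apply: leq_sum => s _; rewrite muln1; case: ifP => [_|].
  by rewrite muln1 (leq_trans (max_card _)) // card_ord leq_addl.
by rewrite addn0; lia.
Qed.

Notation seg b phi d := (fun i : 'I_k => segment n b (phi i * l) (d i)).

Let many_le b : (many b <= \sum_(phi : {ffun 'I_k -> 'I_M} | injectiveb phi)
  \sum_(d : {ffun 'I_k -> 'I_n.+1} | d \in ffun_on (mem D)) joint (iseg n b) (seg b phi d))%N.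
Proof.
rewrite /many /joint -sum1dep_card.
under [X in (_ <= X)%N]eq_bigr => phi _ do under eq_bigr => d _ do rewrite -sum1dep_card big_mkcondr.
under [X in (_ <= X)%N]eq_bigr => phi _ do rewrite exchange_big.
rewrite exchange_big /= big_mkcondr; apply: leq_sum => s sF.
case: ifP => // hk.
set A := [set j | _] in hk.
pose phi := [ffun i : 'I_k => enum_val (widen_ord hk i)].
have phiA i : hit b s (phi i).
  by have := enum_valP (widen_ord hk i); rewrite inE ffunE.
pose d := [ffun i : 'I_k => odflt ord0 [pick d : 'I_n.+1 | (d \in D) && (s @: (iseg n b :\: segment n b (phi i * l) d) \in F)]].
have dP i : (d i \in D) && (s @: (iseg n b :\: segment n b (phi i * l) (d i)) \in F).
  rewrite [d i]ffunE; case: pickP => //= h.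
  by have /existsP [e] := phiA i; rewrite h.
have phi_inj : injectiveb phi.
  apply/injectiveP => i j; rewrite !ffunE => /enum_val_inj /(congr1 val) /= h.
  exact: val_inj.
rewrite (bigD1 phi) //= (bigD1 d) /=; last by apply/ffun_onP => i; case/andP: (dP i).
rewrite -addnA; case: ifP => // /negP []; apply/forallP => i; by case/andP: (dP i).
Qed.

(* All the [M] segments of length [l] have the same probability of producing a hit (swap the blocks);
   the mean number of hits is at least [2 k], hence [k] of them occur with probability
   at least [alpha / 2], and there are at most [M ^ k * #|D| ^ k] ways to choose segments and gaps. *)
Lemma gap_pigeonhole (alpha : rat) : (0 < k)%N -> 0 < alpha ->
  (forall b, (0 < beta F b)%N -> (M * l <= b)%N) ->
  (0 < M)%N -> 2 * k%:R <= alpha * M%:R ->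
  (0 < \sum_(b < n.+1) beta F b)%N ->
  alpha * (\sum_(b < n.+1) beta F b)%:R <= (\sum_(b < n.+1) gap_count D b)%:R ->
  exists (b : 'I_n.+1) (phi : {ffun 'I_k -> 'I_M}) (d : {ffun 'I_k -> 'I_n.+1}),
    [/\ injective phi, forall i, d i \in D &
     forall i, alpha / (4 * k%:R * M%:R ^+ k * #|D|%:R ^+ k) * (beta F (b - d i))%:R <
       (joint (iseg n b) (seg b phi d))%:R].
Proof.
move=> k0 a0 Fl M0 hM; set SB := (\sum_b _)%N => SB0 hK.
set eta := alpha / _.
have eta0 : 0 <= eta by rewrite divr_ge0 ?mulr_ge0 ?exprn_ge0 // ltW.
case: (boolP [exists b : 'I_n.+1, exists phi : {ffun 'I_k -> 'I_M}, exists d : {ffun 'I_k -> 'I_n.+1},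
  [&& injectiveb phi, d \in ffun_on (mem D) & [forall i, eta * (beta F (b - d i))%:R <
       (joint (iseg n b) (seg b phi d))%:R]]]).
  move=> /existsP [b /existsP [phi /existsP [d /and3P [/injectiveP h1 /ffun_onP h2 /forallP h3]]]].
  by exists b, phi, d; split.
rewrite negb_exists => /forallP hno; exfalso.
(* If no triple works, each joint count is at most [eta] times one of the level counts; the sum over
   [i] replaces the unknown index. *)
have hJ (b : 'I_n.+1) (phi : {ffun 'I_k -> 'I_M}) (d : {ffun 'I_k -> 'I_n.+1}) :
   injectiveb phi -> d \in ffun_on (mem D) ->
   (joint (iseg n b) (seg b phi d))%:R <= eta * \sum_i (beta F (b - d i))%:R.
  move=> h1 h2; have := hno b; rewrite negb_exists => /forallP /(_ phi).
  rewrite negb_exists => /forallP /(_ d); rewrite h1 h2 /= negb_forall => /existsP [i].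
  rewrite -leNgt => /le_trans; apply; rewrite ler_wpM2l // (bigD1 i) //= lerDl.
  by rewrite sumr_ge0.
have mlow (b : 'I_n.+1) : (many b)%:R <= (if (M * l <= b)%N then
    \sum_(phi : {ffun 'I_k -> 'I_M} | injectiveb phi)
     \sum_(d : {ffun 'I_k -> 'I_n.+1} | d \in ffun_on (mem D)) eta * \sum_i (beta F (b - d i))%:R else 0) :> rat.
  case: ifP => [_|hb].
    have := many_le b; rewrite -(ler_nat rat) => /le_trans; apply.
    rewrite natr_sum; apply: ler_sum => phi hphi; rewrite natr_sum; apply: ler_sum => d hd.
    exact: hJ.
  (* Levels below [M * l] have no room for the segments, but [F] has no members there. *)
  have : beta F b = 0 by have := Fl b; rewrite hb; case: (beta F b) => // m /(_ isT).
  move=> /eqP; rewrite cards_eq0 => /eqP b0.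
  rewrite (_ : many b = 0) //; apply: eq_card0 => s; have := in_set0 s.
  by rewrite -b0 !inE => ->.
have h1 : M%:R * (\sum_(b < n.+1) gap_count D b)%:R <= k%:R * SB%:R + M%:R * (\sum_(b < n.+1) many b)%:R :> rat.
  rewrite -!natrM -natrD ler_nat !big_distrr -big_split /=; apply: leq_sum => b _.
  have [hb|hb] := leqP (M * l) b; first by apply: le_many; rewrite hb -ltnS ltn_ord.
  have b0 : beta F b = 0 by have := Fl b; rewrite [(M * l <= b)%N]leqNgt hb; case: (beta F b) => // m /(_ isT).
  rewrite (_ : gap_count D b = 0) ?muln0 //; move/eqP: b0; rewrite cards_eq0 => /eqP b0.
  by apply: eq_card0 => s; have := in_set0 s; rewrite -b0 !inE => ->.
have h2 : (\sum_(b < n.+1) many b)%:R <= eta * (k%:R * M%:R ^+ k * #|D|%:R ^+ k * SB%:R).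
  rewrite natr_sum; apply: le_trans (ler_sum _ (fun b _ => mlow b)) _.
  rewrite -big_mkcond /= exchange_big /=.
  under eq_bigr => phi _ do rewrite exchange_big.
  have hd (phi : {ffun 'I_k -> 'I_M}) (d : {ffun 'I_k -> 'I_n.+1}) : d \in ffun_on (mem D) ->
     \sum_(b < n.+1 | (M * l <= b)%N) eta * \sum_i (beta F (b - d i))%:R <= eta * (k%:R * SB%:R).
    move=> /ffun_onP hd; rewrite -mulr_sumr ler_wpM2l // exchange_big /=.
    rewrite -[k in k%:R]card_ord mulr_natl -sumr_const; apply: ler_sum => i _.
    rewrite -natr_sum ler_nat; apply: sum_beta_shift.
    by rewrite (leq_trans (Dl (hd i))) // leq_pmull.
  apply: le_trans (ler_sum _ (fun phi _ => ler_sum _ (hd phi))) _.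
  rewrite !sumr_const -mulrnA -[X in X <= _]mulr_natl natrM card_ffun_on card_ord natrX.
  set c2 := #|D|%:R ^+ k; set c1 := #|_|%:R.
  have c1M : c1 <= M%:R ^+ k.
    have := max_card [pred phi : {ffun 'I_k -> 'I_M} | injectiveb phi].
    by rewrite card_ffun !card_ord -natrX ler_nat.
  rewrite [X in X <= _](_ : _ = eta * (c1 * (c2 * (k%:R * SB%:R)))); last by ring.
  rewrite [X in _ <= X](_ : _ = eta * (M%:R ^+ k * (c2 * (k%:R * SB%:R)))); last by ring.
  by rewrite ler_wpM2l // ler_wpM2r ?mulr_ge0 ?exprn_ge0.
have h3 : eta * (k%:R * M%:R ^+ k * #|D|%:R ^+ k * SB%:R) <= alpha / 4 * SB%:R.
  rewrite mulrA ler_wpM2r // /eta.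
  set c := k%:R * _ * _; rewrite -!mulrA [k%:R * _]mulrA -/c.
  have [->|c0] := eqVneq c 0; first by rewrite mulr0 divr_ge0 // ltW.
  by rewrite invfM -!mulrA mulVf // mulr1.
have SBr : 0 < SB%:R :> rat by rewrite ltr0n.
have Mr : 0 < M%:R :> rat by rewrite ltr0n.
have h4 := ler_wpM2l (ltW Mr) (le_trans h2 h3).
have h5 := ler_wpM2l (ltW Mr) hK.
have h6 := ler_wpM2r (ltW SBr) hM.
have h7 : 0 < alpha * M%:R * SB%:R by rewrite !mulr_gt0.
(* In units of [M * SB], the lower bound [alpha] would be at most [k / M + alpha / 4], while
   [k / M <= alpha / 2]. *)
nra.
Qed.

End Key.
(** * Nondegenerate blow-ups inside the family *)

(** A word has [Delta] letters whatever the size [d] of the set it codes; only its first [d] letters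
    matter. *)
Definition agree Delta (U : eqType) d (w w' : {ffun 'I_Delta -> U}) :=
  [forall a : 'I_Delta, (a < d)%N ==> (w a == w' a)].

Lemma sum_agree Delta R d (w' : {ffun 'I_Delta -> 'I_R}) : (0 < R)%N -> (d <= Delta)%N ->
  \sum_(w : {ffun 'I_Delta -> 'I_R}) (agree d w w')%:R = #|{ffun 'I_Delta -> 'I_R}|%:R / R%:R ^+ d :> rat.
Proof.
move=> R0 dD.
transitivity (\sum_(w : {ffun 'I_Delta -> 'I_R}) \prod_(a < Delta) ((a < d)%N ==> (w a == w' a))%:R : rat).
  apply: eq_bigr => w _; case: (boolP (agree _ _ _)) => [/forallP h|].
    by rewrite big1 // => a _; rewrite h.
  by rewrite negb_forall => /existsP [a /negPf ha]; rewrite (bigD1 a) //= ha mul0r.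
rewrite -(bigA_distr_bigA (fun (a : 'I_Delta) (u : 'I_R) => ((a < d)%N ==> (u == w' a))%:R)) /=.
rewrite (eq_bigr (fun a : 'I_Delta => if (a < d)%N then 1 else R%:R)) => [|a _]; last first.
  case: ifP => _ /=; last by rewrite sumr_const card_ord.
  by rewrite (bigD1 (w' a)) //= eqxx big1 ?addr0 // => u /negPf ->.
have R0' : R%:R != 0 :> rat by rewrite pnatr_eq0 -lt0n.
apply: (canRL (mulfK _)); first by rewrite expf_neq0.
have -> : R%:R ^+ d = \prod_(a < Delta) (if (a < d)%N then R%:R else 1) :> rat.
  by rewrite -big_mkcond (big_ord_narrow dD) /= prodr_const card_ord.
rewrite -big_split /= (eq_bigr (fun=> R%:R)) => [|a _]; last by case: ifP; rewrite ?mul1r ?mulr1.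
by rewrite prodr_const card_ffun !card_ord natrX.
Qed.

Section Configuration.
Variables (n : nat) (F : {set {set 'I_n}}) (k Delta R : nat) (K : finType) (k0 : K).
Variables (B : {set 'I_n}) (I : 'I_k -> {set 'I_n}) (r : rat).
Hypothesis IB : forall i, I i \subset B.
Hypothesis Idis : forall i j, i != j -> [disjoint I i & I j].
Hypothesis kpos : (0 < k)%N.
Hypothesis Ipos : forall i, (0 < #|I i|)%N.
Hypothesis IDelta : forall i, (#|I i| <= Delta)%N.
Hypothesis Rpos : (0 < R)%N.
Hypothesis room : (k * Delta * R + #|B| <= n)%N.
Hypothesis r0 : 0 < r.
Hypothesis Jpos : (0 < joint F B I)%N.
Hypothesis Jlarge : forall i, r * (beta F (#|B| - #|I i|))%:R <= (joint F B I)%:R.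
Hypothesis Rlarge : forall i, k%:R * #|K|%:R ^+ 2 < r ^+ (#|K| ^ k) * R%:R ^+ #|I i|.

Let T := ('I_k * 'I_Delta * 'I_R)%type.
Let cT : #|{: T}| = (k * Delta * R)%N. Proof. by rewrite !card_prod !card_ord. Qed.
Let Tn : (#|{: T}| <= n)%N. Proof. by rewrite cT; lia. Qed.
Let pos (p : T) : 'I_n := widen_ord Tn (enum_rank p).
Let pos_inj : injective pos.
Proof. by move=> p q /(congr1 val) /= h; apply: enum_rank_inj; apply: val_inj. Qed.
Let pos_lt p : (pos p < #|{: T}|)%N. Proof. exact: (ltn_ord (enum_rank p)). Qed.

(** The size of a padding [S0] disjoint from the grid of cells [pos], chosen so that [S0] together
    with one set [D i] per region has as many elements as [B]. *)
Let s0 := (#|B| - \sum_i #|I i|)%N.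
Let S0 : {set 'I_n} := iseg n (#|{: T}| + s0) :\: iseg n #|{: T}|.
Let Om := {ffun 'I_Delta -> 'I_R}.
(** Region [i] is a grid of [Delta] rows of [R] cells; [w] picks one cell in each of the first
    [#|I i|] rows, which gives [R ^ #|I i|] sets of the right size. *)
Let D i (w : Om) : {set 'I_n} := [set pos (i, a, w a) | a in [set a : 'I_Delta | (a < #|I i|)%N]].

Let sumI : (\sum_i #|I i| <= #|B|)%N.
Proof.
have -> : (\sum_i #|I i| = #|\bigcup_i I i|)%N.
  rewrite -[RHS]sum1_card partition_disjoint_bigcup //.
  by apply: eq_bigr => i _; rewrite sum1_card.
by apply: subset_leq_card; apply/bigcupsP.
Qed.

Let card_S0 : #|S0| = s0.
Proof.
rewrite cardsDS ?card_iseg ?cT; try by rewrite /s0; lia.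
by apply/subsetP => x; rewrite !inE; lia.
Qed.

Let card_D i w : #|D i w| = #|I i|.
Proof.
rewrite card_imset; last by move=> a b /pos_inj [].
by rewrite -[RHS](card_iseg (IDelta i)); apply: eq_card => a; rewrite !inE.
Qed.

Let D_dis i j w w' : i != j -> [disjoint D i w & D j w'].
Proof.
move=> ij; rewrite -setI_eq0; apply/set0Pn => -[x]; rewrite inE.
by case/andP=> /imsetP [a _ ->] /imsetP [b _ /pos_inj [eij]]; rewrite eij eqxx in ij.
Qed.

Let S0_dis i w : [disjoint S0 & D i w].
Proof.
rewrite -setI_eq0; apply/set0Pn => -[x]; rewrite inE.
by case/andP=> + /imsetP [a _ ex]; rewrite !inE {1}ex pos_lt.
Qed.

Let D_agree i w w' : D i w = D i w' -> agree #|I i| w w'.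
Proof.
move=> e; apply/forallP => a; apply/implyP => ai.
have : pos (i, a, w a) \in D i w' by rewrite -e; apply/imsetP; exists a; rewrite ?inE.
by case/imsetP=> b _ /pos_inj [-> ->].
Qed.

Let BX (x : {ffun 'I_k -> Om}) := S0 :|: \bigcup_i D i (x i).

Let BXD x i : BX x :\: D i (x i) = S0 :|: \bigcup_(j | j != i) D j (x j).
Proof.
rewrite /BX (bigD1 i) //= setDUl; congr setU.
  by apply/setDidPl; apply: S0_dis.
rewrite setDUl setDv set0U; apply/setDidPl; rewrite disjoint_sym -setI_eq0 big_distrr /=.
by apply/eqP; rewrite big1 // => j ji; apply/eqP; rewrite setI_eq0 D_dis // eq_sym.
Qed.

Let card_BX x : #|BX x| = #|B|.
Proof.
rewrite /BX cardsU (_ : S0 :&: _ = set0) ?cards0 ?subn0; last first.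
  by rewrite big_distrr /= big1 // => i _; apply/eqP; rewrite setI_eq0 S0_dis.
have -> : #|\bigcup_i D i (x i)| = (\sum_i #|I i|)%N.
  rewrite -sum1_card partition_disjoint_bigcup; last by move=> i j; apply: D_dis.
  by apply: eq_bigr => i _; rewrite sum1_card card_D.
by rewrite card_S0 subnK.
Qed.

Let DBX (x : {ffun 'I_k -> Om}) i : D i (x i) \subset BX x.
Proof. by apply: subset_trans (subsetUr _ _); apply: (bigcup_sup i). Qed.

Let V i (s : 'S_n) (x : {ffun 'I_k -> Om}) := s @: (BX x :\: D i (x i)) \in F.
Let G (s : 'S_n) (x : {ffun 'I_k -> Om}) := (s @: BX x \in F) && [forall i, V i s x].

Let Vind i s (x x' : {ffun 'I_k -> Om}) : (forall j, j != i -> x j = x' j) -> V i s x = V i s x'.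
Proof.
move=> h; rewrite /V !BXD; congr (_ @: _ \in F); congr setU.
by apply: eq_bigr => j /h ->.
Qed.

Let GV i s x : G s x -> V i s x. Proof. by case/andP => _ /forallP. Qed.

Let card_G x : #|[set s | G s x]| = joint F B I.
Proof.
have [] // := @perm_sets n k B (BX x) I (fun i => D i (x i)).
- by move=> i j; apply: D_dis.
move=> t [tB tI].
rewrite /joint -[RHS](card_permMl t); apply: eq_card => s; rewrite !inE imset_permM tB.
congr andb; apply: eq_forallb => i; rewrite imset_permM /V.
by rewrite -tB -tI !(can_imset_pre _ (permK t)) preimsetD.
Qed.

Let card_V i x : #|[set s | V i s x]| = beta F (#|B| - #|I i|).
Proof. by rewrite card_imset_in cardsDS // card_BX card_D. Qed.

Notation Y := {ffun 'I_k -> {ffun K -> Om}}.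
Notation c0 := ([ffun=> k0] : {ffun 'I_k -> K}).

Let Om0 : (0 < #|{: Om}|)%N. Proof. by rewrite card_ffun !card_ord expn_gt0 Rpos. Qed.

Let sum_bool (T0 : finType) (P : pred T0) : \sum_s (P s)%:R = #|[set s | P s]|%:R :> rat.
Proof. by rewrite -natr_sum -sum1dep_card [in RHS]big_mkcond; congr _%:R; apply: eq_bigr => s; case: (P s). Qed.

Let sum_V i x : \sum_(s : 'S_n) (V i s x)%:R = (beta F (#|B| - #|I i|))%:R :> rat.
Proof. by rewrite -(card_V i x); exact: (sum_bool (fun s : 'S_n => V i s x)). Qed.

Let sum_G x : \sum_(s : 'S_n) (G s x)%:R = (joint F B I)%:R :> rat.
Proof. by rewrite -(card_G x); exact: (sum_bool (fun s : 'S_n => G s x)). Qed.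

(** Redrawing copy [a] of coordinate [i] alone makes it agree with the fixed copy [b] with
    probability [R ^ - #|I i|]. *)
Let sum_agreeY i (a b : K) : a != b ->
  \sum_(y : Y) (agree #|I i| (y i a) (y i b))%:R = #|{: Y}|%:R / R%:R ^+ #|I i| :> rat.
Proof.
move=> ab.
have cU : #|{: {ffun K -> Om}}|%:R != 0 :> rat.
  by rewrite pnatr_eq0 -lt0n card_ffun expn_gt0 Om0.
have cO : #|{: Om}|%:R != 0 :> rat by rewrite pnatr_eq0 -lt0n.
apply: (mulfI cU).
rewrite -(sum_upd i (fun y : Y => (agree #|I i| (y i a) (y i b))%:R)).
have h (y : Y) : \sum_(u : {ffun K -> Om}) (agree #|I i| (upd y i u i a) (upd y i u i b))%:R
    = #|{: {ffun K -> Om}}|%:R / R%:R ^+ #|I i| :> rat.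
  apply: (mulfI cO).
  under eq_bigr => u _ do rewrite !ffunE eqxx.
  rewrite -(sum_upd a (fun u : {ffun K -> Om} => (agree #|I i| (u a) (u b))%:R)).
  rewrite (eq_bigr (fun=> #|{: Om}|%:R / R%:R ^+ #|I i|)) => [|u _].
    by rewrite sumr_const -[LHS]mulr_natl mulrCA.
  rewrite -(sum_agree (u b) Rpos (IDelta i)); apply: eq_bigr => w _.
  by rewrite !ffunE eqxx eq_sym (negPf ab).
rewrite (eq_bigr _ (fun y _ => h y)) sumr_const -[LHS]mulr_natl; ring.
Qed.

(** Pairs [(s, y)] whose transversals all succeed are counted from below by [blowup]; those with two
    coinciding copies are too few by [Rlarge]. A remaining pair supplies [S] and [E] as images under
    [s]. *)
Lemma exists_configuration : exists (S : {set 'I_n}) (E : 'I_k -> K -> {set 'I_n}),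
  [/\ forall i a, [disjoint S & E i a],
      forall i j a b, i != j -> [disjoint E i a & E j b],
      forall i, injective (E i),
      forall i a, E i a != set0 &
      forall e : 'I_k -> K, S :|: \bigcup_i E i (e i) \in F /\
        forall i, S :|: \bigcup_(j | j != i) E j (e j) \in F].
Proof.
(* With this value [r * v] is exactly the total of [G], and [Jlarge] makes [v] an upper bound for
   the total of each [V i]. *)
pose v : rat := #|{: Y}|%:R * (joint F B I)%:R / r.
have Ypos : 0 < #|{: Y}|%:R :> rat.
  by rewrite ltr0n !card_ffun !expn_gt0 card_ord Rpos.
have vpos : 0 < v by rewrite divr_gt0 // mulr_gt0 // ltr0n.
have sumV i (P : pred Y) : \sum_(s : 'S_n) \sum_(y : Y) (V i s (sel y c0) && P y)%:R =
   (beta F (#|B| - #|I i|))%:R * \sum_(y : Y) (P y)%:R :> rat.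
  rewrite exchange_big /= mulr_sumr; apply: eq_bigr => y _.
  case: (P y); last by rewrite mulr0 big1 // => s _; rewrite andbF.
  under eq_bigr => s _ do rewrite andbT. by rewrite sum_V mulr1.
have hbeta i : (beta F (#|B| - #|I i|))%:R * #|{: Y}|%:R <= v.
  rewrite /v ler_pdivlMr // [X in X <= _]mulrAC mulrC.
  by rewrite ler_wpM2l ?(ltW Ypos) // mulrC.
have hblow := @blowup _ _ K k k0 G V Vind GV Om0 v r (ltW r0).
have {hblow} : r ^+ (#|K| ^ k) * v <= \sum_(s : 'S_n) \sum_(y : Y) [forall e : {ffun 'I_k -> K}, G s (sel y e)]%:R.
  apply: hblow => [i|].
    apply: le_trans (hbeta i).
    have := sumV i predT; rewrite sumr_const -[in RHS]mulr_natr mul1r => <-.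
    by apply: ler_sum => s _; apply: ler_sum => y _; rewrite andbT.
  rewrite exchange_big /= (eq_bigr (fun=> (joint F B I)%:R)) => [|y _]; last by rewrite sum_G.
  by rewrite sumr_const -[X in _ <= X]mulr_natl [r * v]mulrC /v mulfVK // (gt_eqF r0).
pose bad (y : Y) i a b := (a != b) && agree #|I i| (y i a) (y i b).
case: (boolP [exists s : 'S_n, exists y : Y, [forall e : {ffun 'I_k -> K}, G s (sel y e)] &&
   [forall i, forall a, forall b, ~~ bad y i a b]]).
  move=> /existsP [s /existsP [y /andP [/forallP hG /forallP hbad]]] _.
  have simg := imset_inj (@perm_inj _ s).
  have dimg (P Q : {set 'I_n}) : [disjoint P & Q] -> [disjoint s @: P & s @: Q].
    rewrite -!setI_eq0 !(can_imset_pre _ (permK s)) -preimsetI => /eqP ->.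
    by rewrite preimset0.
  have simU (J : pred 'I_k) (f : 'I_k -> {set 'I_n}) :
     s @: (S0 :|: \bigcup_(j | J j) f j) = s @: S0 :|: \bigcup_(j | J j) s @: f j.
    by rewrite imsetU; congr setU; rewrite (big_morph _ (imsetU s) (imset0 s)).
  exists (s @: S0), (fun i a => s @: D i (y i a)); split.
  - by move=> i a; apply: dimg.
  - by move=> i j a b ij; apply: dimg; apply: D_dis.
  - move=> i a b /simg /D_agree h; apply/eqP; apply: contraT => ab.
    by have /forallP /(_ a) /forallP /(_ b) := hbad i; rewrite /bad ab h.
  - by move=> i a; rewrite -card_gt0 card_imset ?card_D //; apply: perm_inj.
  - move=> e; have := hG [ffun i => e i]; set x := sel _ _ => hx.
    have xE i : x i = y i (e i) by rewrite !ffunE.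
    have [h1 /forallP h2] := andP hx; split=> [|i].
      by rewrite -simU; move: h1; rewrite /BX; under eq_bigr => i _ do rewrite xE.
    by rewrite -simU; move: (h2 i); rewrite /V BXD; under eq_bigr => j _ do rewrite xE.
move=> hno hlow; exfalso.
(* Degenerate pairs retain the condition [V i]: its count over [s] is the same for every [y], so a
   coincidence costs its factor relative to [v] and not to all permutations. *)
have key (s : 'S_n) (y : Y) : [forall e : {ffun 'I_k -> K}, G s (sel y e)]%:R <=
   \sum_i \sum_a \sum_b (V i s (sel y c0) && bad y i a b)%:R :> rat.
  case: (boolP [forall _, _]) => [hG|_]; last by rewrite sumr_ge0 // => i _; rewrite sumr_ge0 // => a _; rewrite sumr_ge0.
  have := hno; rewrite negb_exists => /forallP /(_ s); rewrite negb_exists => /forallP /(_ y).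
  rewrite hG /= negb_forall => /existsP [i]; rewrite negb_forall => /existsP [a].
  rewrite negb_forall => /existsP [b]; rewrite negbK => hb.
  have hV : V i s (sel y c0) by apply: GV; apply: (forallP hG c0).
  rewrite (bigD1 i) //= (bigD1 a) //= (bigD1 b) //= hb hV /=.
  rewrite -!addrA lerDl !addr_ge0 ?sumr_ge0 // => j _; rewrite sumr_ge0 // => c _; rewrite sumr_ge0 //.
have hup : \sum_(s : 'S_n) \sum_(y : Y) [forall e : {ffun 'I_k -> K}, G s (sel y e)]%:R <=
   \sum_i \sum_a \sum_b (\sum_(s : 'S_n) \sum_(y : Y) (V i s (sel y c0) && bad y i a b)%:R) :> rat.
  apply: le_trans (ler_sum _ (fun s _ => ler_sum _ (fun y _ => key s y))) _.
  under eq_bigr => s _ do rewrite exchange_big.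
  rewrite exchange_big; apply: ler_sum => i _.
  under eq_bigr => s _ do rewrite exchange_big.
  rewrite exchange_big; apply: ler_sum => a _.
  under eq_bigr => s _ do rewrite exchange_big.
  by rewrite exchange_big.
have hbd i a b : \sum_(s : 'S_n) \sum_(y : Y) (V i s (sel y c0) && bad y i a b)%:R <= v / R%:R ^+ #|I i|.
  rewrite (sumV i (fun y => bad y i a b)) /bad.
  have RI : 0 <= R%:R ^+ #|I i| :> rat by rewrite exprn_ge0.
  have [->|ab] := eqVneq a b; first by rewrite /= big1 // mulr0 divr_ge0 // (ltW vpos).
  by rewrite sum_agreeY //= mulrA ler_wpM2r ?invr_ge0 ?hbeta.
have hk i : k%:R * \sum_(a : K) \sum_(b : K) v / R%:R ^+ #|I i| < r ^+ (#|K| ^ k) * v.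
  have RI : 0 < R%:R ^+ #|I i| :> rat by rewrite exprn_gt0 // ltr0n.
  have -> : \sum_(a : K) \sum_(b : K) v / R%:R ^+ #|I i| = #|K|%:R ^+ 2 * (v / R%:R ^+ #|I i|).
    by rewrite !sumr_const -mulrnA -[LHS]mulr_natl natrM -expr2.
  rewrite mulrA [X in X < _]mulrA ltr_pdivrMr // [X in _ < X]mulrAC ltr_pM2r //.
have hsum : \sum_i \sum_(a : K) \sum_(b : K) v / R%:R ^+ #|I i| < r ^+ (#|K| ^ k) * v.
  have kr : 0 < k%:R :> rat by rewrite ltr0n.
  rewrite -(ltr_pM2l kr) mulr_sumr.
  have -> : k%:R * (r ^+ (#|K| ^ k) * v) = \sum_(i < k) r ^+ (#|K| ^ k) * v.
    by rewrite sumr_const card_ord mulr_natl.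
  apply: ltr_sum => [|i _]; last exact: hk.
  by apply/hasP; exists (Ordinal kpos); rewrite ?mem_index_enum.
suff : r ^+ (#|K| ^ k) * v < r ^+ (#|K| ^ k) * v by rewrite ltxx.
apply: le_lt_trans hlow (le_lt_trans hup (le_lt_trans _ hsum)).
apply: ler_sum => i _; apply: ler_sum => a _; apply: ler_sum => b _; exact: hbd.
Qed.

End Configuration.
(** * Embedding a poset with a k-partite representation *)

Section Embedding.
Variables (n k l : nat) (F : {set {set 'I_n}}).
(** A copy for each vertex and, reserved for the sets that are not rainbow, a copy for each set. *)
Let K : finType := ('I_l + {set 'I_l})%type.
Variables (S : {set 'I_n}) (E : 'I_k -> K -> {set 'I_n}).
Hypothesis SE : forall i a, [disjoint S & E i a].
Hypothesis Edis : forall i j a b, i != j -> [disjoint E i a & E j b].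
Hypothesis Einj : forall i, injective (E i).
Hypothesis E0 : forall i a, E i a != set0.
Hypothesis EF : forall e : 'I_k -> K, S :|: \bigcup_i E i (e i) \in F /\
  forall i, S :|: \bigcup_(j | j != i) E j (e j) \in F.

(** The value [None] omits a region; the result is a member of [F] as long as at most one region is
    omitted. *)
Let W (g : 'I_k -> option K) := S :|: \bigcup_i (if g i is Some a then E i a else set0).

Let W_in (g : 'I_k -> option K) : (#|[set i | ~~ g i]| <= 1)%N -> W g \in F.
Proof.
move=> hg; pose e i := odflt (inr set0) (g i).
have [h1 h2] := EF e.
case: (set_0Vmem [set i | ~~ g i]) => [Z0|[i0 i0Z]].
  rewrite (_ : W g = S :|: \bigcup_i E i (e i)) //; congr setU; apply: eq_bigr => i _.
  by have := in_set0 i; rewrite -Z0 inE /e; case: (g i).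
rewrite (_ : W g = S :|: \bigcup_(j | j != i0) E j (e j)) //; congr setU.
move: (i0Z); rewrite inE => gi0.
rewrite (bigD1 i0) //=; case: (g i0) gi0 => // _; rewrite set0U; apply: eq_bigr => i ii0.
suff : i \notin [set i | ~~ g i] by rewrite inE negbK /e; case: (g i).
apply: contra ii0 => iZ; apply/eqP.
by have /card_le1P := hg; move=> /(_ i0 i0Z i); rewrite iZ => /esym/eqP ->.
Qed.

(** Sets of different regions are disjoint from each other and from [S], so an inclusion of unions
    can be read region by region; nonemptiness of [E i a] shows that [g'] does not omit region
    [i]. *)
Let W_sub (g g' : 'I_k -> option K) i a : W g \subset W g' -> g i = Some a ->
  exists2 b, g' i = Some b & E i a \subset E i b.
Proof.
move=> sub gi.
have main x : x \in E i a -> exists2 b, g' i = Some b & x \in E i b.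
  move=> xE; have : x \in W g'.
    apply: (subsetP sub); rewrite inE; apply/orP; right; apply/bigcupP; exists i => //.
    by rewrite gi.
  rewrite inE => /orP [xS|/bigcupP [j _]].
    by have /disjoint_setI0 /setP /(_ x) := SE i a; rewrite !inE xS xE.
  case gj: (g' j) => [b|]; last by rewrite inE.
  case: (eqVneq i j) gj => [<- gj xb|ij _ xb]; first by exists b.
  by have /disjoint_setI0 /setP /(_ x) := Edis a b ij; rewrite !inE xE xb.
have /set0Pn [x /main [b gb xb]] := E0 i a.
exists b => //; apply/subsetP => y /main [b']; by rewrite gb => -[->].
Qed.

Let W_inj (g g' : 'I_k -> option K) : W g = W g' -> g =1 g'.
Proof.
move=> e.
have half h h' i a : W h = W h' -> h i = Some a -> h' i = Some a.
  move=> eW hi; have [|b hb sab] := W_sub _ hi (g' := h'); first by rewrite eW.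
  have [|a' ha' sba] := W_sub _ hb (g' := h); first by rewrite eW.
  move: ha'; rewrite hi => -[aa']; rewrite -aa' in sba.
  by rewrite hb; congr Some; apply: (@Einj i); apply/eqP; rewrite eqEsubset sab sba.
move=> i; case gi: (g i) => [a|]; first by rewrite (half _ _ _ _ e gi).
by case gi': (g' i) => [a|//]; rewrite (half _ _ _ _ (esym e) gi') in gi.
Qed.

Variable c : 'I_l -> 'I_k.
Let cls (A : {set 'I_l}) i := [set x in A | c x == i].
Let rainbow (A : {set 'I_l}) := [forall i, (#|cls A i| <= 1)%N].
(* A rainbow set chooses a vertex in every part that it meets; the other sets are incomparable to
   everything, and each of them is sent to a member made of vertices reserved for it. *)
Let choice_of (A : {set 'I_l}) (i : 'I_k) : option K :=
  if rainbow A then omap inl [pick x in cls A i] else Some (inr A).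

Let choiceP A i x : rainbow A -> x \in A -> c x = i -> choice_of A i = Some (inl x).
Proof.
move=> rA xA cx; rewrite /choice_of rA; have /card_le1P h := forallP rA i.
have xc : x \in cls A i by rewrite inE xA cx eqxx.
case: pickP => [y yc|/(_ x)]; last by rewrite xc.
by have := h x xc y; rewrite yc => /esym/eqP ->.
Qed.

Let choice_inv A i x : choice_of A i = Some (inl x) -> [/\ rainbow A, x \in A & c x = i].
Proof.
rewrite /choice_of; case: ifP => // rA; case: pickP => //= y; rewrite inE.
by case/andP => yA /eqP cy [<-].
Qed.

(** A strict inclusion in [Pf] goes from size [k - 1] to size [k]. The upper set meets each part
    once, so both sets are rainbow and make the same choices wherever the lower one makes any. *)
Lemma embed_representation (T : finType) (le : rel T) (Pf : {set {set 'I_l}}) : (0 < k)%N ->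
  (forall A, A \in Pf -> #|A| = k.-1 \/ #|A| = k) ->
  weak_subposet le Pf ->
  (forall A, A \in [set A in Pf | #|A| == k] -> forall i, #|cls A i| = 1) ->
  weak_subposet le F.
Proof.
move=> k0 szPf /existsP [f /and3P [/injectiveP finj /forallP fPf /forallP fle]] hc.
have rk A : A \in Pf -> #|A| = k -> rainbow A.
  by move=> AP kA; apply/forallP => i; rewrite hc // inE AP kA eqxx.
have WF A : A \in Pf -> W (choice_of A) \in F.
  move=> AP; apply: W_in.
  case rA: (rainbow A); last first.
    by rewrite (_ : [set i | _] = set0) ?cards0 //; apply/setP => i; rewrite !inE /choice_of rA.
  have cE i : ~~ choice_of A i = (#|cls A i| == 0).
    rewrite /choice_of rA; case: pickP => [x xc|h] /=.
      by apply/esym/negbTE; rewrite cards_eq0; apply/set0Pn; exists x.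
    by apply/esym; rewrite cards_eq0; apply/eqP/setP => x; rewrite h inE.
  have cA : #|A| = (\sum_i #|cls A i|)%N.
    rewrite -sum1_card (partition_big c xpredT) //=; apply: eq_bigr => i _.
    by rewrite -sum1dep_card.
  (* A rainbow set misses exactly [k - #|A|] parts, hence at most one. *)
  have cZ : (#|A| + #|[set i | ~~ choice_of A i]| = k)%N.
    have -> : #|[set i | ~~ choice_of A i]| = (\sum_i (#|cls A i| == 0))%N.
      rewrite -sum1dep_card big_mkcond; apply: eq_bigr => i _; rewrite cE.
      by case: eqP.
    rewrite cA -big_split /= -[RHS]card_ord -sum1_card.
    apply: eq_bigr => i _; have := forallP rA i.
    by case: #|cls A i| => [|[|]].
  by have := szPf A AP; lia.
apply/existsP; exists [ffun u => W (choice_of (f u))]; apply/and3P; split.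
- apply/injectiveP => u v; rewrite !ffunE => /W_inj e; apply: finj.
  case ru: (rainbow (f u)); case rv: (rainbow (f v)).
  + have half A B : rainbow A -> choice_of A =1 choice_of B -> A \subset B.
      move=> rA eAB; apply/subsetP => x xA; have := choiceP rA xA erefl.
      by rewrite eAB => /choice_inv [].
    apply/eqP; rewrite eqEsubset (half _ _ ru e); apply: half rv _ => i; by rewrite e.
  + by have := e (Ordinal k0); rewrite /choice_of ru rv; case: pickP.
  + by have := e (Ordinal k0); rewrite /choice_of ru rv; case: pickP.
  + by have := e (Ordinal k0); rewrite /choice_of ru rv => -[].
- by apply/forallP => u; rewrite ffunE WF.
- apply/forallP => u; apply/forallP => v; apply/implyP => uv; rewrite !ffunE.
  have sAB : f u \subset f v by have /forallP /(_ v) := fle u; rewrite uv.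
  have [->//|nAB] := eqVneq (f u) (f v).
  have /proper_card ltAB : f u \proper f v by rewrite properEneq nAB.
  have kv : #|f v| = k.
    case: (szPf (f v) (fPf v)) => // kv; case: (szPf (f u) (fPf u)) => ku; move: ltAB; rewrite ku kv ?ltnn //.
    by rewrite ltnNge leq_pred.
  have rv := rk _ (fPf v) kv.
  have ru : rainbow (f u).
    apply/forallP => i; apply: leq_trans (forallP rv i); apply: subset_leq_card.
    by apply/subsetP => x; rewrite !inE => /andP [/(subsetP sAB) -> ->].
  apply: setUS; apply/bigcupsP => i _.
  case gi: (choice_of (f u) i) => [[x|B]|]; last by rewrite sub0set.
    have [_ xA cx] := choice_inv gi.
    apply: (bigcup_max i) => //; by rewrite (choiceP rv (subsetP sAB _ xA) cx).
  by move: gi; rewrite /choice_of ru; case: pickP.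
Qed.

End Embedding.
(** * Families in a band of levels *)

Section Band.
Variables (n : nat) (F : {set {set 'I_n}}) (m Delta : nat).
Hypothesis band : forall A, A \in F -> (m <= #|A| <= m + Delta)%N.

Lemma beta_band b : (b <= n)%N -> (0 < beta F b)%N -> (m <= b <= m + Delta)%N.
Proof.
move=> bn /card_gt0P [s]; rewrite inE => /band.
by rewrite card_imset ?card_iseg //; apply: perm_inj.
Qed.

(* All but the smallest member of a chain have another member below them. *)
Lemma sum_beta_le :
  (\sum_(b < n.+1) beta F b <= n`! + \sum_(b < n.+1) gap_count F [set d : 'I_n.+1 | (0 < d <= Delta)%N] b)%N.
Proof.
pose P (s : 'S_n) (b : 'I_n.+1) := s @: iseg n b \in F.
have bandP s b : P s b -> (m <= b <= m + Delta)%N.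
  move/band; rewrite card_imset ?card_iseg //; first by rewrite -ltnS.
  exact: perm_inj.
have -> : n`! = (\sum_(s : 'S_n) 1)%N.
  by rewrite sum1_card -card_Sn; apply: eq_card => s; rewrite !inE.
rewrite /beta /gap_count; under eq_bigr => b _ do rewrite -sum1dep_card big_mkcond.
under [X in (_ <= _ + X)%N]eq_bigr => b _ do rewrite -sum1dep_card big_mkcond.
rewrite exchange_big [X in (_ <= _ + X)%N]exchange_big /=.
rewrite -big_split /=; apply: leq_sum => s _.
have [b0 Pb0|P0] := pickP (P s); last first.
  by rewrite big1 // => b _; have := P0 b; rewrite /P => ->.
case: (arg_minnP val Pb0) => {Pb0} {}b0 Pb0 bmin.
rewrite (bigD1 b0) //= [X in (_ <= _ + X)%N](bigD1 b0) //=.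
apply: leq_add; first by case: ifP.
apply: leq_trans (leq_addl _ _); apply: leq_sum => b bb0.
case: ifP => // Pb.
have b0b := bmin b Pb; have lt : (b0 < b)%N by rewrite ltn_neqAle eq_sym bb0 b0b.
rewrite (_ : [exists d in _, _]) //; apply/existsP.
have hd : (b - b0 < n.+1)%N by apply: leq_ltn_trans (leq_subr _ _) (ltn_ord b).
exists (Ordinal hd); rewrite inE /= subKn // [X in _ && X]Pb0 andbT.
by have := bandP s b Pb; have := bandP s b0 Pb0; lia.
Qed.

Lemma gap_count_split L b :
  (gap_count F [set d : 'I_n.+1 | (0 < d <= Delta)%N] b <=
   \sum_(d : 'I_n.+1 | (0 < d <= L)%N && (d <= Delta)%N) gap_count F [set d] b +
   gap_count F [set d : 'I_n.+1 | (L < d <= Delta)%N] b)%N.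
Proof.
rewrite /gap_count -!sum1dep_card.
under [X in (_ <= X + _)%N]eq_bigr => d _ do rewrite -sum1dep_card big_mkcondr /=.
rewrite exchange_big /= [X in (X <= _)%N]big_mkcondr /= [X in (_ <= _ + X)%N]big_mkcondr -big_split /=.
apply: leq_sum => s _; case: ifP => // /existsP [d]; rewrite inE => /andP [hd sd].
have [dL|dL] := leqP d L.
  rewrite (bigD1 d) /=; last by lia.
  rewrite (_ : [exists e in [set d], _]) //; apply/existsP; exists d.
  by rewrite inE eqxx.
rewrite [X in (_ + X)%N](_ : _ = 1%N) ?addn1 //.
rewrite (_ : [exists e in _, _]) //; apply/existsP; exists d; rewrite inE sd andbT; lia.
Qed.

Lemma sum_half_le1 (N : nat) (P : pred 'I_N.+1) : (forall d, P d -> (0 < d)%N) ->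
  \sum_(d : 'I_N.+1 | P d) 2%:R ^- d <= 1 :> rat.
Proof.
move=> hP; apply: (@le_trans _ _ (\sum_(d < N.+1 | (0 < d)%N) 2%:R ^- d)).
  rewrite big_mkcond [leRHS]big_mkcond; apply: ler_sum => d _.
  have h0 : 0 <= 2%:R ^- d :> rat by rewrite invr_ge0 exprn_ge0.
  by case: ifP => [/hP ->//|_]; case: ifP.
rewrite big_mkcond big_ord_recl /= add0r.
have -> : \sum_(i < N) 2%:R ^- (bump 0 i) = 1 - 2%:R ^- N :> rat; last first.
  by rewrite gerBl invr_ge0 exprn_ge0.
elim: N {P hP} => [|N IH]; first by rewrite big_ord0 expr0 invr1 subrr.
rewrite big_ord_recr /= IH /bump leq0n add1n exprS invfM.
set x := 2%:R ^- N; lra.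
Qed.

(** Since [n!] is at most a fraction [1 / (1 + e)] of the total, a fraction [e'] of the total has a
    gap. The gaps above [L] are allotted half of [e'] and each smaller gap [d] is allotted
    [e' / 2 ^ (d + 1)]; these shares sum to at most [e']. *)
Lemma gap_dichotomy (L : nat) (e : rat) : 0 < e ->
  (1 + e) * (n`!)%:R <= (\sum_(b < n.+1) beta F b)%:R ->
  let e' := e / (1 + e) in
  (e' / 2 * (\sum_(b < n.+1) beta F b)%:R <=
     (\sum_(b < n.+1) gap_count F [set d : 'I_n.+1 | (L < d <= Delta)%N] b)%:R) \/
  exists2 d : 'I_n.+1, (0 < d <= L)%N && (d <= Delta)%N &
    e' / 2 ^+ d.+1 * (\sum_(b < n.+1) beta F b)%:R <= (\sum_(b < n.+1) gap_count F [set d] b)%:R.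
Proof.
move=> e0; set SB := (\sum_(b < n.+1) beta F b)%N => hSB e'.
have e1 : 0 < 1 + e by lra.
have e'0 : 0 < e' by rewrite divr_gt0.
have SB0 : 0 < SB%:R :> rat by apply: lt_le_trans hSB; rewrite mulr_gt0 // ltr0n fact_gt0.
case: lerP => [h|h]; first by left.
case: (boolP [exists d : 'I_n.+1, ((0 < d <= L)%N && (d <= Delta)%N) &&
    (e' / 2 ^+ d.+1 * SB%:R <= (\sum_(b < n.+1) gap_count F [set d] b)%:R)]) => [/existsP [d /andP [h1 h2]]|].
  by right; exists d.
rewrite negb_exists => /forallP hno; exfalso.
have h1 : e' * SB%:R <= (\sum_(b < n.+1) gap_count F [set d : 'I_n.+1 | (0 < d <= Delta)%N] b)%:R.
  have := sum_beta_le; rewrite -(ler_nat rat) natrD -/SB => h1.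
  have -> : e' * SB%:R = SB%:R - SB%:R / (1 + e) by rewrite /e'; field; apply: lt0r_neq0.
  have h2 : n`!%:R <= SB%:R / (1 + e) by rewrite ler_pdivlMr // mulrC.
  lra.
have h2 : (\sum_(b < n.+1) gap_count F [set d : 'I_n.+1 | (0 < d <= Delta)%N] b)%:R <=
   \sum_(d : 'I_n.+1 | (0 < d <= L)%N && (d <= Delta)%N) (\sum_(b < n.+1) gap_count F [set d] b)%:R +
   (\sum_(b < n.+1) gap_count F [set d : 'I_n.+1 | (L < d <= Delta)%N] b)%:R :> rat.
  rewrite -natr_sum -natrD ler_nat exchange_big -big_split /=.
  by apply: leq_sum => b _; apply: gap_count_split.
have h3 : \sum_(d : 'I_n.+1 | (0 < d <= L)%N && (d <= Delta)%N) (\sum_(b < n.+1) gap_count F [set d] b)%:R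
   <= e' / 2 * SB%:R :> rat.
  apply: (@le_trans _ _ (\sum_(d : 'I_n.+1 | (0 < d <= L)%N && (d <= Delta)%N) (e' / 2 * SB%:R) * 2%:R ^- d)).
    apply: ler_sum => d hd; have := hno d; rewrite hd /= -ltNge => /ltW /le_trans; apply.
    by rewrite exprS invfM le_eqVlt; apply/orP; left; apply/eqP; ring.
  rewrite -mulr_sumr; apply: ler_piMr.
    by apply: mulr_ge0 => //; apply: divr_ge0 => //; apply: ltW.
  by apply: sum_half_le1 => d; lia.
lra.
Qed.

Lemma forced_embedding (T : finType) (le : rel T) (k l M : nat) (D : {set 'I_n.+1}) (alpha : rat)
    (R l0 : nat) (Pf : {set {set 'I_l0}}) (c : 'I_l0 -> 'I_k) :
  (0 < k)%N -> 0 < alpha -> (0 < M)%N -> (0 < R)%N -> 2 * k%:R <= alpha * M%:R ->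
  (forall d, d \in D -> (0 < d)%N && (d <= l)%N && (d <= Delta)%N) ->
  (M * l <= m)%N -> (k * Delta * R + (m + Delta) <= n)%N ->
  (0 < \sum_(b < n.+1) beta F b)%N ->
  alpha * (\sum_(b < n.+1) beta F b)%:R <= (\sum_(b < n.+1) gap_count F D b)%:R ->
  (forall d, d \in D -> let t := #|{: 'I_l0 + {set 'I_l0}}| in
     k%:R * t%:R ^+ 2 < (alpha / (4 * k%:R * M%:R ^+ k * #|D|%:R ^+ k)) ^+ (t ^ k) * R%:R ^+ d) ->
  (forall A, A \in Pf -> #|A| = k.-1 \/ #|A| = k) ->
  weak_subposet le Pf ->
  (forall A, A \in [set A in Pf | #|A| == k] -> forall i, #|[set x in A | c x == i]| = 1) ->
  weak_subposet le F.
Proof.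
move=> k0 a0 M0 R0 hM hD hm room SB0 hK hR szPf wPf hc.
have Dl d : d \in D -> (d <= l)%N by move/hD; lia.
have [|b [phi [d [phi_inj dD hJ]]]] := @gap_pigeonhole n F k D l M Dl alpha k0 a0 _ M0 hM SB0 hK.
  move=> b; have [bn|nb] := leqP b n; first by move/(beta_band bn); lia.
  by lia.
set r := alpha / _ in hJ.
have D0 : (0 < #|D|)%N by apply/card_gt0P; exists (d (Ordinal k0)).
have r0 : 0 < r by rewrite divr_gt0 // !mulr_gt0 ?exprn_gt0 // ltr0n.
set J := joint _ _ _ in hJ.
have J0 : (0 < J)%N.
  by have := hJ (Ordinal k0); rewrite -(ltr0n rat); apply: le_lt_trans; rewrite mulr_ge0 // ltW.
have bn : (b <= n)%N by rewrite -ltnS.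
have b0 : (0 < beta F b)%N.
  apply: leq_trans J0 _; apply: subset_leq_card; apply/subsetP => s; rewrite !inE.
  by case/andP.
have hb := beta_band bn b0.
have hphi i : (phi i * l + d i <= b)%N.
  have h1 : (phi i * l + l <= M * l)%N by rewrite -mulSnr leq_mul2r ltn_ord orbT.
  have := Dl _ (dD i); lia.
have cI i : #|segment n b (phi i * l) (d i)| = d i by rewrite card_segment // hphi.
have disI i j : i != j ->
    [disjoint segment n b (phi i * l) (d i) & segment n b (phi j * l) (d j)].
  move=> ij; have dl i' := Dl _ (dD i').
  have gap (x y : nat) : (x < y)%N -> (x * l + l <= y * l)%N.
    by move=> xy; rewrite -mulSnr leq_mul2r xy orbT.
  have hi := hphi i; have hj := hphi j; have di := dl i; have dj := dl j.
  rewrite -setI_eq0; apply/set0Pn => -[x]; rewrite !inE.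
  case: (ltngtP (phi i) (phi j)) => [/gap|/gap|/val_inj /phi_inj e]; try lia.
  by rewrite e eqxx in ij.
have [] := @exists_configuration n F k Delta R
   ('I_l0 + {set 'I_l0})%type (inr set0) (iseg n b) (fun i => segment n b (phi i * l) (d i)) r => //.
- by move=> i; apply/subsetP => x; rewrite !inE; lia.
- by move=> i; rewrite cI; have := hD _ (dD i); lia.
- by move=> i; rewrite cI; have := hD _ (dD i); lia.
- by rewrite card_iseg //; lia.
- by move=> i; rewrite cI card_iseg // ltW.
- by move=> i; rewrite cI; apply: hR.
move=> S [E [h1 h2 h3 h4 h5]].
exact: (embed_representation h1 h2 h3 h4 h5 k0 szPf wPf hc).
Qed.
End Band.

(** As [c <= 1], the bound [c / q ^ d] is at least [(c / q) ^ d], so the right side dominates the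
    [d]-th power of [(c / q) ^ N * R] and a single [R] serves every [d]. *)
Lemma expr_trade (c q x r : rat) (d N R : nat) : 0 < c <= 1 -> 1 <= q -> 1 <= x ->
  x < (c / q) ^+ N * R%:R -> (0 < d)%N -> c / q ^+ d <= r -> x < r ^+ N * R%:R ^+ d.
Proof.
move=> /andP [c0 c1] q1 x1 hx d0 hr.
have q0 : 0 < q by apply: lt_le_trans q1.
have cq0 : 0 < c / q by rewrite divr_gt0.
have h1 : (c / q) ^+ d <= r.
  apply: le_trans hr; rewrite expr_div_n ler_pM2r ?invr_gt0 ?exprn_gt0 //.
  by rewrite -[leRHS]expr1 ler_wiXn2l // ltW.
apply: (@lt_le_trans _ _ (((c / q) ^+ N * R%:R) ^+ d)).
  apply: (lt_le_trans hx _); apply: ler_eXnr => //.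
  by apply: le_trans x1 (ltW hx).
rewrite exprMn -exprM mulnC exprM ler_wpM2r ?exprn_ge0 //.
by rewrite lerXn2r // nnegrE ?exprn_ge0 ?(ltW cq0) // (le_trans _ h1) // exprn_ge0 // ltW.
Qed.

(** Here [Delta <= 5 * p] and [p * Q <= n./2]; the summands of [Q] pay respectively for the blow-up
    grid, for the [M] segments and for the width of the band. *)
Lemma band_arith n k R M Q p m Delta : Q = (5 * (k * R) + 5 * M + 16)%N -> p = (n./2 %/ Q)%N ->
  m = (n./2 - p.*2)%N -> Delta = (n - n./2 + p.*2 - m)%N -> (2 * Q <= n)%N ->
  [/\ (k * Delta * R + (m + Delta) <= n)%N, (M * Delta <= m)%N, (n <= 4 * m)%N &
      (m + Delta = n - n./2 + p.*2)%N].
Proof.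
move=> QE pE mE DE nQ.
have pQ : (p * Q <= n./2)%N by rewrite pE leq_divM.
have p1 : (1 <= p)%N by rewrite pE divn_gt0 QE; lia.
have pQE : (p * Q = 5 * (k * R * p) + 5 * (M * p) + 16 * p)%N by rewrite QE; ring.
have Dp : (Delta <= 5 * p)%N by lia.
have h1 : (k * Delta * R <= 5 * (k * R * p))%N.
  rewrite (_ : 5 * _ = k * (5 * p) * R)%N; last by ring.
  by rewrite leq_mul2r leq_mul2l Dp !orbT.
have h2 : (M * Delta <= 5 * (M * p))%N.
  rewrite (_ : 5 * _ = M * (5 * p))%N; last by ring.
  by rewrite leq_mul2l Dp !orbT.
move: pQ; rewrite pQE; move: h1 h2.
set a := (k * R * p)%N; set b := (M * p)%N; set a' := (_ * R)%N; set b' := (M * _)%N => h1 h2 h3.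
by split; lia.
Qed.

(** * Choice of the constants and the bound on the expected number of chain members *)

Section Lubell.
Variables (T : finType) (le : rel T) (k l0 : nat) (Pf : {set {set 'I_l0}}) (c : 'I_l0 -> 'I_k).
Hypothesis k0 : (0 < k)%N.
Hypothesis szPf : forall A, A \in Pf -> #|A| = k.-1 \/ #|A| = k.
Hypothesis wPf : weak_subposet le Pf.
Hypothesis hc : forall A, A \in [set A in Pf | #|A| == k] -> forall i, #|[set x in A | c x == i]| = 1.

Lemma sum_beta_lt (e : rat) : 0 < e -> exists Q N : nat, (0 < Q)%N /\
  forall n (F : {set {set 'I_n}}), (N <= n)%N ->
    let p := (n./2 %/ Q)%N in
    (forall A, A \in F -> (n./2 - p.*2 <= #|A| <= n - n./2 + p.*2)%N) ->
    ~~ weak_subposet le F ->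
    (\sum_(b < n.+1) beta F b)%:R < (1 + e) * (n`!)%:R.
Proof.
have k3 : (k.+1 <= 3 * k)%N by lia.
move=> e0; have [e' e'E] : exists e', e' = e / (1 + e) by eexists.
have e1 : 0 < 1 + e by lra.
have e'0 : 0 < e' by rewrite e'E divr_gt0.
have e'1 : e' <= 1 by rewrite e'E ler_pdivrMr //; lra.
have kr : 1 <= k%:R :> rat by rewrite ler1n.
have k0r : 0 < k%:R :> rat by rewrite ltr0n.
have ke0 : 0 <= 4 * k%:R / e' by apply: divr_ge0; [apply: mulr_ge0|apply: ltW].
have [M0 M00 hM0] : exists2 M : nat, (0 < M)%N & 4 * k%:R <= e' * M%:R.
  exists (Num.bound (4 * k%:R / e')).+1 => //.
  rewrite [e' * _]mulrC -ler_pdivrMr //; apply: ltW; apply: lt_trans (archi_boundP ke0) _.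
  by rewrite ltr_nat.
have hM2 : 2 * k%:R <= e' / 2 * M0%:R by lra.
have M0r : 1 <= M0%:R :> rat by rewrite ler1n.
(* The constant of [gap_pigeonhole] for [alpha = e' / 2] and [M = M0], stripped of its factor
   [#|D| ^ k]. *)
pose c0 : rat := e' / (8 * k%:R * M0%:R ^+ k).
have den : 1 <= 8 * k%:R * M0%:R ^+ k :> rat.
  have h := @exprn_ege1 _ k _ M0r; nra.
have c00 : 0 < c0 by rewrite divr_gt0 // (lt_le_trans _ den).
have c01 : c0 <= 1 by rewrite ler_pdivrMr ?(lt_le_trans _ den) // mul1r (le_trans e'1).
pose t := #|{: 'I_l0 + {set 'I_l0}}|.
have t0 : (0 < t)%N by apply/card_gt0P; exists (inr set0).
(* The cost per unit of gap in both cases: for large gaps [#|D| <= n + 1 <= 8 ^ d], and for a single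
   gap [2 ^ (d * (k + 1)) <= 8 ^ (k * d)]. *)
pose q : rat := 8 ^+ k.
have q1 : 1 <= q by apply: exprn_ege1.
have q0 : 0 < q by apply: lt_le_trans q1.
pose x : rat := k%:R * t%:R ^+ 2.
have x1 : 1 <= x by rewrite /x mulr_ege1 // exprn_ege1 // ler1n.
have th0 : 0 < (c0 / q) ^+ (t ^ k) by rewrite exprn_gt0 // divr_gt0.
have [R R0 hR] : exists2 R : nat, (0 < R)%N & x < (c0 / q) ^+ (t ^ k) * R%:R.
  exists (Num.bound (x / (c0 / q) ^+ (t ^ k))).+1 => //.
  rewrite [X in _ < X]mulrC -ltr_pdivrMr //; apply: lt_trans (archi_boundP _) _.
    by rewrite divr_ge0 // ltW // (lt_le_trans _ x1).
  by rewrite ltr_nat.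
have [Q QE] : exists Q, Q = (5 * (k * R) + 5 * M0 + 16)%N by eexists.
exists Q, (8 ^ (4 * M0) + 2 * Q)%N; split; first by rewrite QE addn_gt0 orbT.
move=> n F nN p band wF; rewrite ltNge; apply/negP => hSB.
have nQ : (2 * Q <= n)%N by apply: leq_trans (leq_addl _ _) nN.
have nM : (8 ^ (4 * M0) <= n)%N by apply: leq_trans (leq_addr _ _) nN.
have [m mE] : exists m, m = (n./2 - p.*2)%N by eexists.
have [Delta DE] : exists D, D = (n - n./2 + p.*2 - m)%N by eexists.
have [room MD m4 mD] := band_arith QE erefl mE DE nQ.
have band' A : A \in F -> (m <= #|A| <= m + Delta)%N by rewrite mD mE; apply: band.
have SB0 : (0 < \sum_(b < n.+1) beta F b)%N.
  by rewrite -(ltr0n rat); apply: lt_le_trans hSB; rewrite mulr_gt0 // ltr0n fact_gt0.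
(* Base 8 leaves room for [M0 * 2 ^ d] segments of length [d <= L]: four times their total length is
   at most [4 * M0 * 4 ^ L <= 8 ^ L <= n <= 4 * m]. The summand [8 ^ (4 * M0)] of the threshold
   gives [4 * M0 <= 2 ^ L]. *)
pose L := trunc_log 8 n.
have n0 : (0 < n)%N by apply: leq_trans nM; rewrite expn_gt0.
have Ln : (8 ^ L <= n)%N by apply: trunc_logP.
have nL : (n < 8 ^ L.+1)%N by apply: trunc_log_ltn.
have L4 : (4 * M0 <= 2 ^ L)%N.
  have : (4 * M0 <= L)%N by apply: trunc_log_max.
  by move=> h; apply: leq_trans h (ltnW (ltn_expl _ _)).
have emb := @forced_embedding n F m Delta band' T le k.
case: (gap_dichotomy band' L e0 hSB); rewrite -e'E.
  move=> hK; case/negP: wF.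
  apply: (emb Delta M0 [set d : 'I_n.+1 | (L < d <= Delta)%N] (e' / 2) R l0 Pf c) => //.
  - by rewrite divr_gt0.
  - move=> d; rewrite inE => /andP [dL ->]; by rewrite (leq_ltn_trans _ dL).
  - move=> d; rewrite inE => /andP [dL dD] /=; apply: (@expr_trade c0 q) => //; rewrite ?c00 // ?(leq_ltn_trans _ dL) //.
    set D := #|_|.
    have D0 : (0 < D)%N by apply/card_gt0P; exists d; rewrite inE dL.
    have Dd : (D <= 8 ^ d)%N.
      apply: leq_trans (max_card _) _; rewrite card_ord; apply: leq_trans nL _.
      by rewrite leq_exp2l.
    have -> : e' / 2 / (4 * k%:R * M0%:R ^+ k * D%:R ^+ k) = c0 / D%:R ^+ k.
      rewrite /c0; field; rewrite !expf_neq0 ?pnatr_eq0 -?lt0n //=.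
    rewrite ler_pM2l // lef_pV2 ?posrE ?exprn_gt0 ?ltr0n //.
    by rewrite /q -!natrX -expnM mulnC expnM ler_nat leq_exp2r.
case=> d /andP [/andP [d0 dL] dD] hK; case/negP: wF.
(* The number of segments grows with [2 ^ d] to offset the density [e' / 2 ^ (d + 1)] of a single
   gap. *)
apply: (emb d (M0 * 2 ^ d)%N [set d] (e' / 2 ^+ d.+1) R l0 Pf c) => //.
- by rewrite divr_gt0 // exprn_gt0.
- by rewrite muln_gt0 M00 expn_gt0.
- rewrite natrM natrX exprS invfM (_ : e' * _ * _ = e' / 2 * M0%:R) //.
  by field; rewrite expf_neq0.
- by move=> d'; rewrite inE => /eqP ->; rewrite d0 leqnn.
- have h1 : (2 ^ d <= 2 ^ L)%N by rewrite leq_exp2l.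
  have h2 : (d <= 2 ^ L)%N by apply: leq_trans dL (ltnW (ltn_expl _ _)).
  have h3 : (8 ^ L = 2 ^ L * 2 ^ L * 2 ^ L)%N by rewrite -!expnMn.
  have h4 : (M0 * 2 ^ d * d <= M0 * 2 ^ L * 2 ^ L)%N by rewrite leq_mul ?leq_mul.
  have h5 : (4 * (M0 * 2 ^ L * 2 ^ L) <= 8 ^ L)%N by rewrite h3 !mulnA !leq_mul.
  apply: leq_trans h4 _; rewrite -(leq_pmul2l (isT : (0 < 4)%N)).
  by apply: leq_trans h5 (leq_trans Ln m4).
- move=> d'; rewrite inE => /eqP -> /=; apply: (@expr_trade c0 q) => //; rewrite ?c00 //.
  rewrite cards1 expr1n mulr1 natrM natrX exprMn.
  have -> : e' / 2 ^+ d.+1 / (4 * k%:R * (M0%:R ^+ k * (2 ^+ d) ^+ k)) = c0 / (2 ^+ d * (2 ^+ d) ^+ k).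
    rewrite /c0 exprS; field; rewrite !expf_neq0 ?pnatr_eq0 -?lt0n //=.
  rewrite ler_pM2l // lef_pV2 ?posrE ?mulr_gt0 ?exprn_gt0 ?ltr0n //.
  rewrite -exprS /q -!exprM -!natrX ler_nat (_ : 8 = 2 ^ 3)%N // -expnM leq_exp2l //.
  by rewrite mulnA [(3 * k * d)%N]mulnC leq_mul2l k3 orbT.
Qed.

End Lubell.
(** * Binomial tails *)

Lemma bin_incr n j : (j < n./2)%N -> ('C(n, j) <= 'C(n, j.+1))%N.
Proof.
move=> hj; rewrite -(leq_pmul2l (ltn0Sn j)) mul_bin_left leq_mul2r.
by apply/orP; right; lia.
Qed.

Lemma bin_mono n i j : (i <= j <= n./2)%N -> ('C(n, i) <= 'C(n, j))%N.
Proof.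
elim: j => [|j IH] /andP [ij jn]; first by move: ij; rewrite leqn0 => /eqP ->.
move: ij; rewrite leq_eqVlt => /orP [/eqP -> //|ij].
by apply: leq_trans (IH _) (bin_incr _) => //; rewrite -ltnS ij ltnW.
Qed.

Lemma bin_le_half n b : ('C(n, b) <= 'C(n, n./2))%N.
Proof.
have [bn|nb] := leqP b n; last by rewrite bin_small.
have [bh|hb] := leqP b n./2; first by apply: bin_mono; rewrite bh leqnn.
by rewrite -bin_sub //; apply: bin_mono; lia.
Qed.

Section Tail.
Variables (n Q : nat).
Hypothesis nQ : (2 * Q <= n)%N.
Hypothesis Q0 : (0 < Q)%N.
Let p := (n./2 %/ Q)%N.

(** The inductive step needs [(Q + 1) * (b + 1) <= Q * (n - b)], which holds because
    [b + 1 <= n./2 - p] and [n./2 < 2 * Q * p]. *)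
Let sum_bin b : (b <= n./2 - p)%N -> (\sum_(j < b) 'C(n, j) <= Q * 'C(n, b))%N.
Proof.
elim: b => [|b IH] hb; first by rewrite big_ord0.
rewrite big_ord_recr /=; apply: (@leq_trans (Q.+1 * 'C(n, b))%N).
  by rewrite mulSnr leq_add2r IH // ltnW.
rewrite -(leq_pmul2l (ltn0Sn b)) !mulnA [(b.+1 * Q)%N]mulnC -[(Q * b.+1 * _)%N]mulnA mul_bin_left mulnA.
rewrite leq_mul2r; apply/orP; right.
have h1 : (n./2 < Q * p.+1)%N by rewrite mulnC ltn_ceil.
have p1 : (1 <= p)%N by rewrite divn_gt0 //; lia.
have h2 : (Q * p.+1 <= 2 * (Q * p))%N by rewrite mulnCA leq_mul2l; lia.
have h3 : (Q * (b.+1 + 2 * p) <= Q * (n - b))%N by rewrite leq_mul2l; lia.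
by apply: leq_trans h3; lia.
Qed.

(* [C(n, j + 1) / C(n, j) >= 1 + 1 / Q] for [j < n./2 - p], so that [C(n, b)] dominates
   the sum of the preceding binomials; this is used twice. *)
Lemma low_tail : (p * \sum_(j < n./2 - p.*2) 'C(n, j) <= Q ^ 2 * 'C(n, n./2))%N.
Proof.
have h1 : (p * 'C(n, n./2 - p.*2) <= Q * 'C(n, n./2))%N.
  have hp : (p.*2 <= n./2)%N \/ (n./2 < p.*2)%N by lia.
  case: hp => hp; last first.
    rewrite (_ : (n./2 - p.*2 = 0)%N); last by lia.
    rewrite bin0 muln1; apply: leq_trans (_ : Q * n./2 <= _)%N.
      by apply: leq_trans (leq_div _ _) _; rewrite leq_pmull.
    rewrite leq_mul2l; apply/orP; right.
    have [->|n0] := posnP n./2; first by [].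
    by rewrite (leq_trans _ (bin_mono (_ : (1 <= n./2 <= n./2)%N))) ?bin1 ?n0 ?leqnn //; lia.
  have h2 := sum_bin (leqnn (n./2 - p)).
  have h3 : (Q * 'C(n, n./2 - p) <= Q * 'C(n, n./2))%N by rewrite leq_mul2l bin_le_half orbT.
  apply: leq_trans (leq_trans _ h2) h3.
  (* Only the last [p] levels of the sum are kept; by monotonicity each is at least the lowest of
     them. *)
  rewrite -(big_mkord xpredT (fun j => 'C(n, j))) (@big_cat_nat _ _ _ (n./2 - p.*2)) //=; last by lia.
  apply: leq_trans (leq_addl _ _).
  rewrite {1}(_ : p = (n./2 - p) - (n./2 - p.*2))%N; last by lia.
  rewrite -sum_nat_const_nat big_nat [X in (_ <= X)%N]big_nat; apply: leq_sum => j hj.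
  by apply: bin_mono; lia.
have h2 : (\sum_(j < n./2 - p.*2) 'C(n, j) <= Q * 'C(n, n./2 - p.*2))%N by apply: sum_bin; lia.
apply: leq_trans (_ : p * (Q * 'C(n, n./2 - p.*2)) <= _)%N; first by rewrite leq_mul2l h2 orbT.
by rewrite mulnCA expnS expn1 -mulnA leq_mul2l h1 orbT.
Qed.
End Tail.

(** * Counting sets by size, and the final estimate *)

Lemma card_small_sets n a : (a <= n.+1)%N ->
  #|[set A : {set 'I_n} | (#|A| < a)%N]| = (\sum_(j < a) 'C(n, j))%N.
Proof.
move=> an; rewrite -sum1dep_card.
have inF (A : {set 'I_n}) : (#|A| < n.+1)%N by rewrite ltnS (leq_trans (max_card _)) // card_ord.
rewrite (partition_big (fun A : {set 'I_n} => Ordinal (inF A)) (fun j : 'I_n.+1 => (j < a)%N)) //=.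
rewrite (big_ord_narrow an) /=; apply: eq_bigr => j _.
transitivity 'C(#|'I_n|, j); last by rewrite card_ord.
rewrite -card_draws -sum1dep_card; apply: eq_bigl => A.
rewrite -val_eqE /=; case: eqP => [->|]; rewrite ?andbF ?andbT //; exact: ltn_ord.
Qed.

Lemma card_large_sets n a : (a <= n.+1)%N ->
  #|[set A : {set 'I_n} | (n < #|A| + a)%N]| = (\sum_(j < a) 'C(n, j))%N.
Proof.
move=> an; rewrite -card_small_sets // -(card_preimset _ (inv_inj (@setCK _))).
apply: eq_card => A; rewrite !inE cardsCs setCK card_ord.
have : (#|A| <= n)%N by rewrite (leq_trans (max_card _)) // card_ord.
lia.
Qed.

(** [beta F b / n!] is the fraction of level [b] that lies in [F], and no level exceeds the middle
    one; the sum of these fractions is the Lubell function of [F]. *)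
Lemma card_le_sum_beta n (F : {set {set 'I_n}}) :
  (#|F| * n`! <= 'C(n, n./2) * \sum_(b < n.+1) beta F b)%N.
Proof.
have inF (A : {set 'I_n}) : (#|A| < n.+1)%N by rewrite ltnS (leq_trans (max_card _)) // card_ord.
rewrite -sum1_card (partition_big (fun A : {set 'I_n} => Ordinal (inF A)) xpredT) //=.
rewrite big_distrl big_distrr /=; apply: leq_sum => b _.
rewrite (_ : (\sum_(i in F | _) 1)%N = #|[set A in F | #|A| == b]|); last first.
  by rewrite -sum1dep_card; apply: eq_bigl => A; rewrite -val_eqE.
by rewrite card_level ?leq_mul2r ?bin_le_half ?orbT // -ltnS.
Qed.

Lemma weak_subposetS (T U : finType) (le : rel T) (F G : {set {set U}}) :
  F \subset G -> weak_subposet le F -> weak_subposet le G.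
Proof.
move=> FG /existsP [f /and3P [h1 /forallP h2 h3]]; apply/existsP; exists f.
by rewrite h1 h3 andbT; apply/forallP => u; apply: (subsetP FG).
Qed.

(** Nested sets of equal size coincide, so an embedding would collapse the two elements of a longest
    chain. *)
Lemma level_free (T U : finType) (le : rel T) (h : nat) : height le = 2%N ->
  ~~ weak_subposet le [set A : {set U} | #|A| == h].
Proof.
move=> hle; apply/negP => /existsP [f /and3P [/injectiveP finj /forallP flev /forallP fle]].
have [C cC hC] : {C : {set T} | chainb le C & height le = #|C|}.
  apply: eq_bigmax_cond; apply/card_gt0P; exists set0.
  by apply/forallP => x; rewrite inE.
have /eqP /cards2P [x [y [xy Cxy]]] : #|C| = 2%N by rewrite -hC.
have eqf u v : le u v -> u = v.
  move=> uv; apply: finj; apply/eqP; rewrite eqEcard.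
  have /forallP /(_ v) := fle u; rewrite uv /= => ->.
  have := flev u; have := flev v; rewrite !inE => /eqP h1 /eqP h2. by rewrite h1 h2 /= leqnn.
have /forallP /(_ x) := cC; rewrite Cxy !inE eqxx /= => /forallP /(_ y).
rewrite !inE eqxx orbT /= => /orP [/eqf|/eqf] e; by rewrite e eqxx in xy.
Qed.

(* La(n,P) = (1 + o(1)) * C(n, floor(n/2)), i.e. La(n,P) / C(n, floor(n/2)) -> 1 *)
Theorem theorem2 (T : finType) (le : rel T) (k : nat) :
  is_partial_order le -> height le = 2%N -> (2 <= k)%N ->
  k_partite_representation le k ->
  forall eps : rat, 0 < eps -> exists N : nat, forall n : nat, (N <= n)%N ->
    `| (La le n)%:R / ('C(n, n./2))%:R - 1 | < eps.
Proof.
move=> _ hle k2 [l0 [Pf [szPf wPf [c hc]]]] eps eps0.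
have k0 : (0 < k)%N by apply: leq_trans k2.
have e20 : 0 < eps / 2 by rewrite divr_gt0.
have [Q [N [Q0 hN]]] := sum_beta_lt k0 szPf wPf hc e20.
(* Forces [p > 4 * Q ^ 2 / eps], so that each tail, at most [Q ^ 2 / p] times the middle binomial,
   is at most [eps / 4] of it. *)
pose P0 := Num.bound (4 * Q%:R ^+ 2 / eps).
exists (N + 2 * Q * P0.+1)%N => n nN.
have nN1 : (N <= n)%N by apply: leq_trans nN; rewrite leq_addr.
have nQP : (2 * Q * P0.+1 <= n)%N by apply: leq_trans nN; rewrite leq_addl.
have nQ : (2 * Q <= n)%N by apply: leq_trans nQP; rewrite leq_pmulr.
have C0 : 0 < ('C(n, n./2))%:R :> rat by rewrite ltr0n bin_gt0; lia.
set CC : rat := ('C(n, n./2))%:R in C0 *.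
have La_ge : CC <= (La le n)%:R.
  rewrite ler_nat; have -> : 'C(n, n./2) = #|[set A : {set 'I_n} | #|A| == n./2]|.
    by rewrite card_draws card_ord.
  have hM : ~~ weak_subposet le [set A : {set 'I_n} | #|A| == n./2] by apply: level_free.
  rewrite /La.
  exact: (@leq_bigmax_cond _ (fun F : {set {set 'I_n}} => ~~ weak_subposet le F) (fun F => #|F|) _ hM).
have [F wF LaE] : {F : {set {set 'I_n}} | ~~ weak_subposet le F & La le n = #|F|}.
  apply: eq_bigmax_cond; apply/card_gt0P; exists [set A : {set 'I_n} | #|A| == n./2].
  exact: level_free.
have La_lt : (La le n)%:R < (1 + eps) * CC.
  rewrite LaE; pose p := (n./2 %/ Q)%N.
  have pP : (P0 < p)%N by rewrite leq_divRL //; lia.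
  have p0 : 0 < p%:R :> rat by rewrite ltr0n; apply: leq_ltn_trans pP.
  pose a := (n./2 - p.*2)%N.
  have an : (a <= n.+1)%N by lia.
  have pn : (p <= n./2)%N by apply: leq_div.
  pose B := [set A in F | (n./2 - p.*2 <= #|A| <= n - n./2 + p.*2)%N].
  (* A set outside the band has size below [a] or above [n - a]; [eps] is split into one half for
     the band and a quarter for each tail. *)
  have cover : (#|F| <= #|B| + (\sum_(j < a) 'C(n, j) + \sum_(j < a) 'C(n, j)))%N.
    rewrite -{1}(card_small_sets an) -(card_large_sets an).
    apply: leq_trans (leq_trans (leq_card_setU _ _) (leq_add (leqnn _) (leq_card_setU _ _))).
    apply: subset_leq_card; apply/subsetP => A AF; rewrite !inE AF /=.
    have : (#|A| <= n)%N by rewrite (leq_trans (max_card _)) // card_ord.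
    by rewrite /a; lia.
  have hB : #|B|%:R < (1 + eps / 2) * CC.
    have f0 : 0 < n`!%:R :> rat by rewrite ltr0n fact_gt0.
    have h : (\sum_(b < n.+1) beta B b)%:R < (1 + eps / 2) * n`!%:R.
      apply: (hN n B nN1) => [A|]; first by rewrite inE => /andP [].
      by apply: contra wF; apply: weak_subposetS; apply/subsetP => A; rewrite inE => /andP [].
    rewrite -(ltr_pM2r f0).
    have := card_le_sum_beta B; rewrite -(ler_nat rat) !natrM -/CC => h1.
    apply: le_lt_trans h1 _; rewrite mulrAC mulrC ltr_pM2r //.
  have tail : (\sum_(j < a) 'C(n, j))%:R <= eps / 4 * CC.
    have := low_tail nQ Q0; rewrite -/p -/a -(ler_nat rat) natrM (natrM _ (Q ^ 2)) natrX -/CC => h1.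
    rewrite -(ler_pM2l p0); apply: le_trans h1 _; rewrite mulrA ler_pM2r //.
    have : 4 * Q%:R ^+ 2 / eps < p%:R.
      apply: lt_trans (archi_boundP _) _; last by rewrite ltr_nat.
      by rewrite divr_ge0 ?mulr_ge0 ?exprn_ge0 // ltW.
    rewrite ltr_pdivrMr //; lra.
  have := cover; rewrite -(ler_nat rat) !natrD; lra.
rewrite ger0_norm; last by rewrite subr_ge0 ler_pdivlMr // mul1r.
by rewrite ltrBlDr ltr_pdivrMr // addrC.
Qed.
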